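(* For $1\le p\le t-1$ and $R'=\tau_pR$, one has $\chi_{R'}(\tau_pw)=\tau_p(\chi_R(w))$ for all $w\in W(R)$.
   Context: $\sim_K$ is Knuth equivalence; $w|_B$ is the subword of $w$ of letters in $B$; tableaux are in English notation, column-strict meaning rows weakly increase and columns strictly increase; $\mathrm{word}(T)=\dotsb u^2u^1$ with $u^i$ the $i$-th row of $T$ read left to right; $P(w)$, $Q(w)$ are the Schensted row-insertion and recording tableaux. $R=(R_1,\dots,R_t)$ is a sequence of rectangular partitions, $R_i$ with $\eta_i$ rows and $\mu_i$ columns; $n=\sum\eta_i$; $A_i=\{\eta_1+\dots+\eta_{i-1}+1,\dots,\eta_1+\dots+\eta_i\}$; $Y_i$ is the column-strict tableau of shape $R_i$ whose $j$-th row consists of $\mu_i$ copies of $\eta_1+\dots+\eta_{i-1}+j$. $W(R)$ is the set of words $w$ in $[n]$ with $w|_{A_i}\sim_K\mathrm{word}(Y_i)$ for all $i$; $\mathrm{LRT}(\lambda;R)$ is the set of column-strict tableaux of shape $\lambda$ with word in $W(R)$. Rectangle switching: $\tau_pR=(R_1,\dots,R_{p-1},R_{p+1},R_p,R_{p+2},\dots,R_t)$. For $t=2$, $\tau_1:\mathrm{LRT}(\lambda;(R_1,R_2))\to\mathrm{LRT}(\lambda;(R_2,R_1))$ is the unique map (both sets are empty or singletons of equal size) and $\tau_1:W((R_1,R_2))\to W((R_2,R_1))$ is defined by $P(\tau_1w)=\tau_1P(w)$, $Q(\tau_1w)=Q(w)$. For general $t$, $\tau_pw$ is obtained from $w\in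 W(R)$ by replacing the subword $w|_{A_p\cup A_{p+1}}$ (same positions) by its image under the two-rectangle map for $(R_p,R_{p+1})$ (letters shifted down by $\eta_1+\dots+\eta_{p-1}$ and back up); $\tau_pw\in W(\tau_pR)$. Cyclage map: for $1\le r\le n-1$ and a word $u$, regard letters $r$ as right parentheses and $r+1$ as left parentheses, match them, leaving an unmatched subword $r^a(r+1)^b$; $s_ru$ replaces it by $r^b(r+1)^a$. These give an action of $S_n$ on words. $w_0^R$ is the longest element of the Young subgroup of $S_n$ stabilizing each $A_i$. For $w=ux$ with $x$ a letter, $\chi_R(w)=(w_0^Rx)(w_0^Ru)$; $\chi_R$ maps $W(R)$ to itself. *)

(* Defs.v *)
From Stdlib Require Import Relations ClassicalEpsilon.
From mathcomp Require Import all_boot.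

Set Implicit Arguments.
Unset Strict Implicit.
Unset Printing Implicit Defensive.

(* A word is a seq nat (letters are positive integers).
   A tableau is a seq of rows (English notation), row 1 first. *)
Definition word := seq nat.
Definition tableau := seq (seq nat).

Definition shape (T : tableau) : seq nat := map size T.

Definition tword (T : tableau) : word := flatten (rev T).

Fixpoint cols_ok (T : tableau) : bool :=
  match T with
  | r1 :: ((r2 :: _) as T') =>
      all (fun j => nth 0 r1 j < nth 0 r2 j) (iota 0 (size r2)) && cols_ok T'
  | _ => true
  end.

Definition column_strict (T : tableau) : bool :=
  [&& all (fun r => 0 < size r) T, all (sorted leq) T,
      sorted (fun a b => b <= a) (shape T) & cols_ok T].

Inductive knuth_step : word -> word -> Prop :=
  | knuth_xzy (a b : word) (x y z : nat) :
      x <= y -> y < z -> knuth_step (a ++ [:: x; z; y] ++ b) (a ++ [:: z; x; y] ++ b)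
  | knuth_yxz (a b : word) (x y z : nat) :
      x < y -> y <= z -> knuth_step (a ++ [:: y; x; z] ++ b) (a ++ [:: y; z; x] ++ b).

Definition knuth_equiv : word -> word -> Prop :=
  clos_refl_sym_trans word knuth_step.

Fixpoint ins_row (x : nat) (row : seq nat) : option nat * seq nat :=
  match row with
  | [::] => (None, [:: x])
  | y :: r => if x < y then (Some y, x :: r)
              else let: (b, r') := ins_row x r in (b, y :: r')
  end.

(* row insertion into a tableau; also returns the (0-based) row of the new cell *)
Fixpoint ins (x : nat) (T : tableau) : tableau * nat :=
  match T with
  | [::] => ([:: [:: x]], 0)
  | row :: T' =>
      let: (b, row') := ins_row x row in
      match b with
      | None => (row' :: T', 0)
      | Some y => let: (T'', k) := ins y T' in (row' :: T'', k.+1)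
      end
  end.

Fixpoint add_at (k v : nat) (Q : tableau) : tableau :=
  match Q, k with
  | [::], _ => [:: [:: v]]
  | r :: Q', 0 => rcons r v :: Q'
  | r :: Q', k'.+1 => r :: add_at k' v Q'
  end.

Fixpoint RS_aux (w : word) (P Q : tableau) (i : nat) : tableau * tableau :=
  match w with
  | [::] => (P, Q)
  | x :: w' => let: (P', k) := ins x P in RS_aux w' P' (add_at k i Q) i.+1
  end.

Definition RS (w : word) : tableau * tableau := RS_aux w [::] [::] 1.
Definition Ptab (w : word) : tableau := (RS w).1.
Definition Qtab (w : word) : tableau := (RS w).2.

(* R is a sequence of rectangles R_i = (eta_i, mu_i) : eta_i rows, mu_i columns.
   Indices i are 1-based as in the paper: R_i = nth (0,0) R i.-1, t = size R. *)
Definition rect (R : seq (nat * nat)) (i : nat) : nat * nat := nth (0, 0) R i.-1.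
Definition eta (R : seq (nat * nat)) (i : nat) : nat := (rect R i).1.
Definition mu (R : seq (nat * nat)) (i : nat) : nat := (rect R i).2.
Definition ntot (R : seq (nat * nat)) : nat := sumn (map fst R).
Definition off (R : seq (nat * nat)) (i : nat) : nat := sumn (take i.-1 (map fst R)).

Definition inA (R : seq (nat * nat)) (i : nat) (x : nat) : bool :=
  (off R i < x) && (x <= off R i + eta R i).

Definition Ytab (R : seq (nat * nat)) (i : nat) : tableau :=
  [seq nseq (mu R i) (off R i + j) | j <- iota 1 (eta R i)].

Definition inW (R : seq (nat * nat)) (w : word) : Prop :=
  all (fun x => (1 <= x) && (x <= ntot R)) w /\
  forall i, 1 <= i <= size R ->
    knuth_equiv [seq x <- w | inA R i x] (tword (Ytab R i)).

Definition LRT (lam : seq nat) (R : seq (nat * nat)) (T : tableau) : Prop :=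
  shape T = lam /\ column_strict T /\ inW R (tword T).

Definition tauR (R : seq (nat * nat)) (p : nat) : seq (nat * nat) :=
  take p.-1 R ++ [:: rect R p.+1; rect R p] ++ drop p.+1 R.

(* t = 2: the unique map LRT(lam;(R1,R2)) -> LRT(lam;(R2,R1))
   (both sides are empty or singletons), lam = shape of the argument *)
Definition tau1_tab (R1 R2 : nat * nat) (T : tableau) : tableau :=
  epsilon (inhabits [::]) (fun T' => LRT (shape T) [:: R2; R1] T').

Definition tau1_word (R1 R2 : nat * nat) (w : word) : word :=
  epsilon (inhabits [::])
    (fun u => Ptab u = tau1_tab R1 R2 (Ptab w) /\ Qtab u = Qtab w).

Fixpoint replace_sub (B : pred nat) (w : word) (s : word) : word :=
  match w with
  | [::] => [::]
  | x :: w' =>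
      if B x then
        match s with
        | [::] => x :: replace_sub B w' [::]
        | y :: s' => y :: replace_sub B w' s'
        end
      else x :: replace_sub B w' s
  end.

Definition tau_word (R : seq (nat * nat)) (p : nat) (w : word) : word :=
  let a := off R p in
  let B := fun x => (a < x) && (x <= a + eta R p + eta R p.+1) in
  let s := [seq x - a | x <- [seq x <- w | B x]] in
  let s' := [seq y + a | y <- tau1_word (rect R p) (rect R p.+1) s] in
  replace_sub B w s'.

(* indices (0-based) of letters r, r+1 that are matched, reading r+1 as a
   left parenthesis and r as a right parenthesis *)
Fixpoint match_aux (r : nat) (u : word) (i : nat) (stk m : seq nat) : seq nat :=
  match u with
  | [::] => m
  | x :: u' =>
      if x == r.+1 then match_aux r u' i.+1 (i :: stk) m
      else if x == r then
        match stk with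
        | [::] => match_aux r u' i.+1 stk m
        | j :: stk' => match_aux r u' i.+1 stk' (i :: j :: m)
        end
      else match_aux r u' i.+1 stk m
  end.

Definition matched (r : nat) (u : word) : seq nat := match_aux r u 0 [::] [::].

Definition unmatched (r : nat) (u : word) : seq nat :=
  [seq i <- iota 0 (size u) |
     (nth 0 u i \in [:: r; r.+1]) && (i \notin matched r u)].

(* s_r u : replace the unmatched subword r^a (r+1)^b by r^b (r+1)^a *)
Definition s_act (r : nat) (u : word) : word :=
  let U := unmatched r u in
  let b := count (fun i => nth 0 u i == r.+1) U in
  [seq (if i \in U then (if index i U < b then r else r.+1) else nth 0 u i)
   | i <- iota 0 (size u)].

Definition act (gs : seq nat) (u : word) : word := foldr s_act u gs.

(* reduced word of the longest element of the symmetric group on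
   {a+1, ..., a+h}:  s_{a+1} (s_{a+2} s_{a+1}) ... (s_{a+h-1} ... s_{a+1}) *)
Definition w0_block (a h : nat) : seq nat :=
  flatten [seq [seq a + k | k <- rev (iota 1 j)] | j <- iota 1 h.-1].

(* w_0^R : longest element of the Young subgroup stabilizing each A_i *)
Definition w0R (R : seq (nat * nat)) : seq nat :=
  flatten [seq w0_block (off R i) (eta R i) | i <- iota 1 (size R)].

Definition chi (R : seq (nat * nat)) (w : word) : word :=
  match w with
  | [::] => [::]
  | _ => act (w0R R) [:: last 0 w] ++ act (w0R R) (take (size w).-1 w)
  end.

(* Main.v *)
From Stdlib Require Import Relations ClassicalEpsilon.
From mathcomp Require Import all_boot zify.
Require Import Defs.

(* Write Q(w) for the recording tableau and w = u x. The crystal operators, hence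
   w_0^R and tau, do not change Q, and Q of a word y v is determined by Q(v) and
   by the shape of P(y v); moreover LRT(lambda; R) has at most one element. So,
   after a reduction to two rectangles, the two sides agree as soon as
   chi_R(w) and chi_R'(tau w) have the same shape. Both shapes are obtained, like
   the shape of w, by adding a cell to the shape of u, and at most two shapes
   obtained in this way occur in the product of R_1 and R_2. If chi_R does not
   change the shape of w, then the last letter of w and, after reversing and
   complementing, the first letter of chi_R(w) both bound the position of the
   removed cell, and force it to lie in R_1 or in R_2 placed at the origin. But if
   two shapes are available then their intersection, the shape of u, contains both
   rectangles. Hence chi_R and chi_R' both change the shape whenever this is
   possible. *)

Set Implicit Arguments.
Unset Strict Implicit.
Unset Printing Implicit Defensive.

(** * Crystal operators on words *)

(** The reflection s_r rewrites all unmatched letters at once, whereas Schensted insertion is easy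
    to follow only for one letter changed at a time. In [chi] the reflections act on a single letter
    and on a word of W(R) without its last letter. In the latter only the block of the deleted
    letter is affected: one copy of its smallest letter is missing, so at each step exactly one r+1
    is unmatched and s_r is a single raising operator, while the remaining factors of w_0^R fix the
    result. This turns w_0^R u into a chain of raisings, which keeps Q. The maps [tau1_tab] and
    [tau1_word] are given by a choice operator, so existence has to be proved as well: reversing and
    complementing w gives a tableau of the same shape for the exchanged rectangles, and a word with
    prescribed P and Q is found by passing through highest weight words. That the partitions are
    rectangles enters through multiplicities: the letters of a block occur equally often, so no
    unmatched r+1 means no unmatched r, and the condition becomes symmetric under reversal with
    complement. *)

Fixpoint phi (r : nat) (u : word) : nat :=
  if u is x :: v then
    if x == r.+1 then (phi r v).-1 else if x == r then (phi r v).+1 else phi r v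
  else 0.

(** In the bracketing of [s_act], [eps] counts the unmatched r+1 and [phi] the unmatched r. A letter
    r+1 put in front is matched with an unmatched r of the rest if there is one, whence the
    truncated predecessor in [phi] and the test in [eps]. *)
Fixpoint eps (r : nat) (u : word) : nat :=
  if u is x :: v then
    if x == r.+1 then eps r v + (phi r v == 0) else eps r v
  else 0.

(* The raising operator turns the leftmost unmatched r+1 into r; it is the
   identity when every r+1 is matched. *)
Fixpoint raise (r : nat) (u : word) : word :=
  if u is x :: v then
    if (x == r.+1) && (phi r v == 0) then r :: v else x :: raise r v
  else [::].

(** Meant for words with an unmatched r, where it inverts [raise]; on other words it may change a
    matched r, as in [[:: r.+1; r]]. *)
Fixpoint lower (r : nat) (u : word) : word :=
  if u is x :: v then
    if (x == r) && (phi r v == 0) then r.+1 :: v else x :: lower r v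
  else [::].

Lemma phi_cat r u v : phi r (u ++ v) = phi r u + (phi r v - eps r u).
Proof.
elim: u => [|x u IH] /=; first by rewrite subn0.
by rewrite IH; case: eqP => _; [|case: eqP => _]; case: (phi r u) => [|p] /=; lia.
Qed.

Lemma eps_cat r u v : eps r (u ++ v) = eps r v + (eps r u - phi r v).
Proof.
elim: u => [|x u IH] /=; first by rewrite addn0.
by rewrite IH phi_cat; case: eqP => // _; lia.
Qed.

Lemma raise_eps0 r u : eps r u = 0 -> raise r u = u.
Proof.
elim: u => //= x u IH; case: eqP => [->|_] /=; last by move/IH->.
by case: eqP => /= _ h; [lia | rewrite IH; [|lia]].
Qed.

(** The tensor product rule: an unmatched r+1 of u survives in [u ++ v] exactly when u has more of
    them than v has unmatched r. *)
Lemma raise_cat r u v :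
  raise r (u ++ v) = if phi r v < eps r u then raise r u ++ v else u ++ raise r v.
Proof.
elim: u => [|x u IH] //=; rewrite phi_cat IH.
case: eqP => /= _; last by case: ifP.
case E: (phi r u == 0) => /=; case: ltnP => h; case: eqP => h' /=; case: ltnP => h'' //=; lia.
Qed.

Lemma raiseP r u : 0 < eps r u ->
  exists p q, [/\ u = p ++ r.+1 :: q, eps r p = 0, phi r q = 0
                & raise r u = p ++ r :: q].
Proof.
elim: u => //= x u IH; case: (eqVneq x r.+1) => [->|nx] /=.
  case: eqP => [h0 _|/eqP h0]; first by exists [::], u.
  rewrite addn0 => /IH [p [q [eu hp hq ->]]].
  exists (r.+1 :: p), q; rewrite eu /= eqxx hp hq; split => //.
  by case: (phi r p =P 0) => // hp0; move: h0; rewrite eu phi_cat /= eqxx hp0 hq.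
move=> /IH [p [q [-> hp hq ->]]].
by exists (x :: p), q; split => //=; rewrite (negbTE nx).
Qed.

Lemma raise_at r p q : eps r p = 0 -> phi r q = 0 ->
  raise r (p ++ r.+1 :: q) = p ++ r :: q.
Proof. by move=> hp hq; rewrite raise_cat hp /= eqxx hq. Qed.

Lemma lower_at r p q : eps r p = 0 -> phi r q = 0 ->
  lower r (p ++ r :: q) = p ++ r.+1 :: q.
Proof.
move=> + hq; elim: p => [|x p IH] /=; first by rewrite hq !eqxx.
move=> hp; rewrite IH; last by move: hp; case: eqP; lia.
have hp0 : eps r p = 0 by move: hp; case: eqP; lia.
suff -> : (phi r (p ++ r :: q) == 0) = false by rewrite andbF.
by rewrite phi_cat /= hq hp0 eqxx (ltn_eqF (ltnSn r)); lia.
Qed.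

Lemma raiseK r u : 0 < eps r u -> lower r (raise r u) = u.
Proof. by move=> /raiseP [p [q [-> hp hq ->]]]; rewrite lower_at. Qed.

Lemma phi_split r u : 0 < phi r u ->
  exists p q, [/\ u = p ++ r :: q, eps r p = 0 & phi r q = 0].
Proof.
elim: u => //= x u IH.
case: (posnP (phi r u)) => [h0|/[dup] hu /IH [p [q [eu hp hq]]]].
  rewrite h0; case: eqP => //= _; case: eqP => // -> _.
  by exists [::], u.
case: (eqVneq x r.+1) => [->|nx] h; last first.
  by exists (x :: p), q; rewrite eu /= (negbTE nx).
exists (r.+1 :: p), q; rewrite eu /= eqxx; split=> //.
suff -> : (phi r p == 0) = false by rewrite addn0.
by move: h; rewrite eu phi_cat /= hq hp eqxx (ltn_eqF (ltnSn r)); lia.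
Qed.

Lemma raise_surj r u : 0 < phi r u -> exists2 v, 0 < eps r v & raise r v = u.
Proof.
move=> /phi_split [p [q [-> hp hq]]]; exists (p ++ r.+1 :: q); last exact: raise_at.
by rewrite eps_cat /= eqxx hq; lia.
Qed.

Lemma eps_raise r u : 0 < eps r u -> (eps r (raise r u)).+1 = eps r u.
Proof.
move=> /raiseP [p [q [-> hp hq ->]]].
by rewrite !eps_cat /= !eqxx (ltn_eqF (ltnSn r)) hp hq eqxx; lia.
Qed.

Lemma phi_raise r u : 0 < eps r u -> phi r (raise r u) = (phi r u).+1.
Proof.
move=> /raiseP [p [q [-> hp hq ->]]].
by rewrite !phi_cat /= !eqxx (ltn_eqF (ltnSn r)) hp hq; lia.
Qed.

Lemma size_raise r u : size (raise r u) = size u.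
Proof. by elim: u => //= x u IH; case: ifP => //= _; rewrite IH. Qed.

Lemma raise_letters r (B : pred nat) u : B r -> all B u -> all B (raise r u).
Proof.
move=> Br; elim: u => //= x u IH /andP[hx hu]; case: ifP => /= _.
  by rewrite Br.
by rewrite hx IH.
Qed.

Lemma phi_eps_count r u : phi r u + count_mem r.+1 u = eps r u + count_mem r u.
Proof.
elim: u => //= x u IH; case: (eqVneq x r.+1) => [->|] /=.
  by rewrite (gtn_eqF (ltnSn r)); lia.
by case: (eqVneq x r) => /=; lia.
Qed.

Lemma count_raise r y u : 0 < eps r u ->
  count_mem y (raise r u) + (y == r.+1) = count_mem y u + (y == r).
Proof.
move=> /raiseP [p [q [-> _ _ ->]]].
by rewrite !count_cat /= ![_ == y]eq_sym; lia.
Qed.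

Lemma sumn_raise r u : 0 < eps r u -> (sumn (raise r u)).+1 = sumn u.
Proof. by move=> /raiseP [p [q [-> _ _ ->]]]; rewrite !sumn_cat /=; lia. Qed.

Lemma eps_count r u : eps r u <= count_mem r.+1 u.
Proof. by elim: u => //= x u IH; case: eqP => _; lia. Qed.

Lemma phi_count r u : phi r u <= count_mem r u.
Proof.
elim: u => //= x u IH; case: (eqVneq x r.+1) => [->|_].
  by lia.
by case: (eqVneq x r) => /= _; lia.
Qed.

Lemma eps_filter r (B : pred nat) u : B r -> B r.+1 ->
  (eps r (filter B u) = eps r u) * (phi r (filter B u) = phi r u).
Proof.
move=> Br Br1; elim: u => //= x u [IHe IHp].
case: ifP => /= [_|hx]; first by rewrite IHe IHp.
have /negbTE-> : x != r.+1 by apply: contraFneq hx => ->.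
by have /negbTE-> : x != r by apply: contraFneq hx => ->.
Qed.

Lemma raise_filter r (B : pred nat) u : B r -> B r.+1 ->
  filter B (raise r u) = raise r (filter B u).
Proof.
move=> Br Br1; elim: u => //= x u IH.
case: (eqVneq x r.+1) => [->|nx] /=.
  rewrite Br1 /= eqxx /= eps_filter //; case: ifP => _ /=; rewrite ?Br ?Br1 //.
  by rewrite IH.
by case: ifP => /= hx; rewrite IH ?(negbTE nx).
Qed.

Lemma raise_filterN r (B : pred nat) u : ~~ B r -> ~~ B r.+1 ->
  filter B (raise r u) = filter B u.
Proof.
move=> /negbTE Br /negbTE Br1; elim: u => //= x u IH.
case: (eqVneq x r.+1) => [->|nx] /=.
  by rewrite Br1; case: ifP => _ /=; rewrite ?Br ?Br1.
by rewrite IH.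
Qed.

Lemma phi_sorted r s : sorted leq s -> phi r s = count_mem r s.
Proof.
elim: s => //= x s IH h; rewrite (IH (path_sorted h)).
case: (eqVneq x r.+1) => [ex|_]; last by case: eqP.
rewrite ex (gtn_eqF (ltnSn r)) add0n.
suff -> : count_mem r s = 0 by [].
apply/count_memPn/negP => /(allP (order_path_min leq_trans h)); rewrite ex; lia.
Qed.

Lemma eps_sorted r s : sorted leq s -> eps r s = count_mem r.+1 s.
Proof. by move=> h; have := phi_eps_count r s; rewrite (phi_sorted r h); lia. Qed.

(** * Row insertion and crystal operators *)

Lemma tword_cons r T : tword (r :: T) = tword T ++ r.
Proof. by rewrite /tword rev_cons flatten_rcons. Qed.

Lemma ins_row_bump x row y row' : ins_row x row = (Some y, row') -> x < y.
Proof.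
elim: row row' => //= z row IH row'; case: ifP => [? [<-] //|_].
by case E: (ins_row x row) => [[b|] r] //= [eb _]; apply: (IH r); rewrite E eb.
Qed.

Lemma ins_row_None x row row' : ins_row x row = (None, row') -> row' = rcons row x.
Proof.
elim: row row' => [|z row IH] row' /=; first by case=> <-.
case: ifP => // _; case E: (ins_row x row) => [[b|] r] //= [<-].
by rewrite (IH r E).
Qed.

Lemma ins_row_mem x row : x \in (ins_row x row).2.
Proof.
elim: row => [|z row IH] /=; first by rewrite mem_seq1.
case: ifP => _; first by rewrite mem_head.
by case: (ins_row x row) IH => b r /= IH; rewrite inE IH orbT.
Qed.

Lemma ins_row_perm x row :
  perm_eq (seq_of_opt (ins_row x row).1 ++ (ins_row x row).2) (x :: row).
Proof.
elim: row => [|z row IH] //=; case: ifP => _ /=.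
  by apply/permP => a /=; lia.
case: (ins_row x row) IH => b r /= /permP IH; apply/permP => a.
by have := IH a; rewrite !count_cat /=; lia.
Qed.

Lemma ins_row_all (B : pred nat) x row :
  all B (seq_of_opt (ins_row x row).1 ++ (ins_row x row).2) = B x && all B row.
Proof. by rewrite (perm_all _ (ins_row_perm x row)). Qed.

Lemma ins_row_sorted x row : sorted leq row -> sorted leq (ins_row x row).2.
Proof.
elim: row => //= z row IH h; have hz := order_path_min leq_trans h.
case: ltnP => hx /=.
  by apply: path_le h; [exact: leq_trans|exact: ltnW].
have := ins_row_all (leq z) x row; rewrite hx hz.
case: (ins_row x row) (IH (path_sorted h)) => b r /= hs.
rewrite all_cat => /andP[_ hr].
by rewrite path_min_sorted.
Qed.

Definition xraise (r x : nat) : nat := if x == r.+1 then r else x.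

(* One row insertion, viewed as the rewriting of row x into y row', is an
   isomorphism of crystals. *)
Lemma ins_row_crystal r x row : sorted leq row ->
  let: (b, row') := ins_row x row in
  [/\ eps r (seq_of_opt b ++ row') = eps r (rcons row x),
      phi r (seq_of_opt b ++ row') = phi r (rcons row x) &
      (if (x == r) < eps r row then ins_row x (raise r row)
       else ins_row (xraise r x) row)
      = if b is Some y then
          if (y == r.+1) && (phi r row' == 0) then (Some r, row')
          else (Some y, raise r row')
        else (None, raise r row')].
Proof.
elim: row => [|z row IH] h.
  by split => //=; rewrite /xraise; case: eqP.
have hz := order_path_min leq_trans h.
have hs := path_sorted h.
have cz c : c < z -> count_mem c row = 0.
  by move=> hc; apply/count_memPn/negP => /(allP hz); lia.
have [c0 c1] := (cz r, cz r.+1).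
have e1 := eps_sorted r hs; have e0 := phi_sorted r hs.
rewrite /=; case: ltnP => hx.
  rewrite -cats1 /= eps_cat phi_cat /= {IH}.
  case: (eqVneq z r.+1) => [ez|nz] /=.
    subst z; have n0 := c0 (ltnSn r); rewrite e0 n0 /= ?eqxx.
    rewrite (ltn_eqF hx).
    split; [by case: (x =P r) => _ /=; lia|by case: (x =P r) => _ /=; lia|].
    case: (eqVneq x r) => [ex|nx] /=; last by rewrite addn1 /= (_ : x < r) //; lia.
    subst x; rewrite addn1 ltnS e1; case: ltnP => hn.
      (* Raising has turned the head r+1 into r, so the inserted r passes it and bumps the next
         entry, which is r+1 too because the sorted tail still contains r+1. *)
      rewrite ltnn; case: row h hz hs {c0 c1 cz e1} e0 n0 hn => [|w row] //= h /andP[hw hz] hs e0 n0 hn.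
      have -> : w = r.+1.
        apply: contraTeq hn => nw; rewrite (negbTE nw) -leqNgt leqn0 add0n.
        have /(order_path_min leq_trans) hw2 := hs.
        by apply/eqP/count_memPn/negP => /(allP hw2); lia.
      rewrite ltnSn eqxx /=; suff -> : phi r row = 0 by [].
      by apply/eqP; rewrite -leqn0 (leq_trans (phi_count r row)) // -[X in _ <= X]n0 leq_addl.
    by rewrite /xraise (ltn_eqF (ltnSn r)) ltnSn raise_eps0 // e1; lia.
  split; [by case: (x =P r.+1) => ? /=; case: (x =P r) => ? /=; case: (z =P r) => ? /=; lia|by case: (x =P r.+1) => ? /=; case: (x =P r) => ? /=; case: (z =P r) => ? /=; lia|].
  case: ltnP => hc.
    rewrite /= hx; case: (eqVneq x r.+1) => //= ex.
    by move: hc; rewrite e1 c1; lia.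
  rewrite /xraise; case: (eqVneq x r.+1) => /= ex.
    by rewrite (_ : r < z); [rewrite e0 c0 //|]; lia.
  by rewrite hx raise_eps0 //; move: hc; rewrite e1; case: eqP; lia.
have := ins_row_bump (x := x) (row := row).
have := ins_row_sorted x hs; have := ins_row_mem x row.
have := ins_row_all (leq z) x row; rewrite hx hz.
move: (IH hs); case Ei: (ins_row x row) => [b row'] /= [IHe IHp IHr].
rewrite all_cat => /andP[_ hz'] hxin hs' hb.
have cz' c : c < z -> count_mem c row' = 0.
  by move=> hc; apply/count_memPn/negP => /(allP hz'); lia.
have {cz'} [c0' c1'] := (cz' r, cz' r.+1).
have e1' := eps_sorted r hs'; have e0' := phi_sorted r hs'.
have x0 : x = r -> 0 < count_mem r row' by move=> <-; rewrite -has_count has_pred1.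
split.
- case: b IHe IHp {IHr Ei} hb => [y|] /= IHe IHp hb; rewrite -?IHe -?IHp //.
  by move/(_ _ _ erefl): hb; rewrite e1' e0'; do ?case: eqP; lia.
- case: b IHe IHp {IHr Ei} hb => [y|] /= IHe IHp hb; rewrite -?IHe -?IHp //.
  by move/(_ _ _ erefl): hb; rewrite e0'; do ?case: eqP; lia.
have hy y : b = Some y -> x < y by move=> eb; apply: (hb y row'); rewrite eb.
case: (eqVneq z r.+1) => [ez|nz] /=.
  subst z; rewrite e0 (c0 (ltnSn r)) eqxx /= (gtn_eqF hx) addn1 /= (ltnNge x r) (ltnW hx) /= Ei.
  case: b hy {IHe IHp IHr hb Ei} => [y|] hy; rewrite e0' (c0' (ltnSn r)) eqxx //.
  by rewrite (gtn_eqF (leq_ltn_trans hx (hy _ erefl))).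
rewrite (ltnNge x z) hx /=; have -> : (if (x == r) < eps r row
    then let '(b0, r') := ins_row x (raise r row) in (b0, z :: r')
    else
     if xraise r x < z
     then (Some z, xraise r x :: row)
     else let '(b0, r') := ins_row (xraise r x) row in (b0, z :: r'))
   = let '(b0, r') := (if (x == r) < eps r row
           then ins_row x (raise r row)
           else ins_row (xraise r x) row) in (b0, z :: r').
  case: ifP => // _; case: ltnP => // hxz; exfalso.
  by move: hxz hx nz; rewrite /xraise; case: eqP; lia.
rewrite IHr; case: b hy {IHe IHp IHr hb Ei} => [y|] hy //.
have := hy _ erefl => {}hy.
(* With z = r and y = r+1, the letter x is r itself and sits in row', so [phi r row'] is not 0. *)
case: (eqVneq z r) => [ez|nzr]; last by case: ifP.
rewrite andbF; case: (eqVneq y r.+1) => //= ey.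
by rewrite e0'; case: eqP => // h0; have := x0; rewrite h0; lia.
Qed.

(** [raise] transported to tableaux without changing the shape: the test is that of [raise_cat] for
    the reading word [tword T' ++ row]. *)
Fixpoint traise (r : nat) (T : tableau) : tableau :=
  if T is row :: T' then
    if phi r row < eps r (tword T') then row :: traise r T' else raise r row :: T'
  else [::].

Lemma tword_traise r T : tword (traise r T) = raise r (tword T).
Proof.
elim: T => [//|row T IH] /=.
by rewrite tword_cons raise_cat; case: ifP => _; rewrite tword_cons ?IH.
Qed.

Lemma ins_cons x row T :
  ins x (row :: T) = let: (b, row') := ins_row x row in
    if b is Some y then (row' :: (ins y T).1, (ins y T).2.+1) else (row' :: T, 0).
Proof. by rewrite /=; case: (ins_row x row) => [[y|] row'] //; case: (ins y T). Qed.

Lemma phi_rcons r u x : phi r (rcons u x) = phi r u + ((x == r) - eps r u).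
Proof.
rewrite -cats1 phi_cat /=; case: (eqVneq x r.+1) => [->|_]; last by case: eqP.
by rewrite (gtn_eqF (ltnSn r)).
Qed.

Lemma eps_rcons r u x : eps r (rcons u x) = (x == r.+1) + (eps r u - (x == r)).
Proof.
rewrite -cats1 eps_cat /=; case: (eqVneq x r.+1) => [->|_]; last by case: eqP.
by rewrite (gtn_eqF (ltnSn r)).
Qed.

Lemma raise_rcons r u x :
  raise r (rcons u x) =
    if (x == r) < eps r u then rcons (raise r u) x else rcons u (xraise r x).
Proof.
rewrite -!cats1 raise_cat /= /xraise.
by case: (eqVneq x r.+1) => [->|_]; rewrite ?(gtn_eqF (ltnSn r)) //=.
Qed.

(** A bump rewrites [rcons row x] as [y :: row'] at the end of the reading word, so
    [ins_row_crystal] and the tensor product rule pass the claim on to the rows below. *)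
Lemma ins_crystal r x T : all (sorted leq) T ->
  [/\ eps r (tword (ins x T).1) = eps r (rcons (tword T) x),
      phi r (tword (ins x T).1) = phi r (rcons (tword T) x) &
      (if (x == r) < eps r (tword T) then ins x (traise r T)
       else ins (xraise r x) T) = (traise r (ins x T).1, (ins x T).2)].
Proof.
elim: T x => [|row T IH] x.
  by move=> _; split => //=; rewrite /xraise; case: eqP.
move=> /andP[srow sT].
have := ins_row_crystal r x srow; rewrite ?(ins_cons x row T); have := ins_row_None (x := x) (row := row).
case Ei: (ins_row x row) => [[y|] row'] hN /=.
  have [IHe IHp IHr] := IH y sT.
  case Ey: (ins y T) IHe IHp IHr => [T' k] /= IHe IHp IHr [].
  rewrite eps_rcons phi_rcons => he hp hr.
  rewrite !tword_cons rcons_cat !eps_cat !phi_cat IHe IHp !eps_rcons !phi_rcons.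
  split; [by move: he hp; do ?case: eqP => ? /=; lia|by move: he hp; do ?case: eqP => ? /=; lia|].
  rewrite -/(ins (xraise r x) (row :: T)).
  have hp' : phi r row + ((x == r) - eps r row) = (y == r) + (phi r row' - (y == r.+1)).
    by rewrite -hp; do ?case: eqP => ? /=; lia.
  (* The left-hand side is [phi r (y :: row')], so [hA] decides whether raising acts in the rows
     below or in the current row and its letter. *)
  case: (ltnP ((y == r) + (phi r row' - (y == r.+1))) (eps r (tword T))) => hA.
    have -> : phi r row < eps r (tword T) by lia.
    have -> : (x == r) < eps r row + (eps r (tword T) - phi r row) by lia.
    have -> : phi r row' < (y == r.+1) + (eps r (tword T) - (y == r)) by lia.
    move: IHr; have -> : (y == r) < eps r (tword T) by lia.
    by move=> IHr; rewrite ins_cons Ei IHr.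
  have -> : (if (x == r) < eps r row + (eps r (tword T) - phi r row)
     then ins x (if phi r row < eps r (tword T) then row :: traise r T
                 else raise r row :: T)
     else ins (xraise r x) (row :: T))
    = let: (b, row0) := (if (y == r.+1) && (phi r row' == 0) then (Some r, row')
       else (Some y, raise r row')) in
      if b is Some y then (row0 :: (ins y T).1, (ins y T).2.+1) else (row0 :: T, 0).
    rewrite -hr; case: (ltnP (x == r) (eps r row)) => hx.
      have -> : (phi r row < eps r (tword T)) = false by lia.
      have -> : (x == r) < eps r row + (eps r (tword T) - phi r row) by lia.
      by rewrite ins_cons.
    have -> : ((x == r) < eps r row + (eps r (tword T) - phi r row)) = false by lia.
    by rewrite ins_cons.
  case: ifP => [/andP[/eqP ey /eqP h0]|hn].
    move: IHr; rewrite ey h0 eqxx (gtn_eqF (ltnSn r)).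
    move: hA; rewrite ey eqxx h0 (gtn_eqF (ltnSn r)) /= leqn0 => /eqP ->.
    by rewrite /xraise eqxx ltnn => ->.
  have -> : (phi r row' < (y == r.+1) + (eps r (tword T) - (y == r))) = false.
    by move: hA hn; do ?case: eqP => ? /=; lia.
  by rewrite Ey.
case=> he hp hr; rewrite {hN}(hN _ erefl) /= in he hp hr Ei *.
rewrite !tword_cons rcons_cat; split => //.
rewrite -/(ins (xraise r x) (row :: T)) eps_cat phi_rcons.
case: (ltnP (phi r row + ((x == r) - eps r row)) (eps r (tword T))) => hA.
  have -> : phi r row < eps r (tword T) by lia.
  have -> : (x == r) < eps r row + (eps r (tword T) - phi r row) by lia.
  by rewrite ins_cons Ei.
case: (ltnP (x == r) (eps r row)) hr => hx hr.
  have -> : (phi r row < eps r (tword T)) = false by lia.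
  have -> : (x == r) < eps r row + (eps r (tword T) - phi r row) by lia.
  by rewrite ins_cons hr.
have -> : ((x == r) < eps r row + (eps r (tword T) - phi r row)) = false by lia.
by rewrite ins_cons hr.
Qed.

(** * The Schensted correspondence *)

Lemma RS_aux_rcons w x P Q i :
  RS_aux (rcons w x) P Q i =
    let S := RS_aux w P Q i in
    ((ins x S.1).1, add_at (ins x S.1).2 (i + size w) S.2).
Proof.
elim: w P Q i => [|y w IH] P Q i /=.
  by rewrite addn0; case: (ins x P).
by case: (ins y P) => P' k; rewrite IH /= addnS.
Qed.

Lemma Ptab_rcons w x : Ptab (rcons w x) = (ins x (Ptab w)).1.
Proof. by rewrite /Ptab /RS RS_aux_rcons. Qed.

Lemma Qtab_rcons w x :
  Qtab (rcons w x) = add_at (ins x (Ptab w)).2 (size w).+1 (Qtab w).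
Proof. by rewrite /Qtab /Ptab /RS RS_aux_rcons. Qed.

Fixpoint cells_from (T : tableau) (w : word) : seq nat :=
  if w is x :: w' then (ins x T).2 :: cells_from (ins x T).1 w' else [::].

(* The rows of the successive new cells; this carries the same information as
   the recording tableau. *)
Definition cells (w : word) : seq nat := cells_from [::] w.

Lemma cells_rcons w x : cells (rcons w x) = rcons (cells w) (ins x (Ptab w)).2.
Proof.
rewrite /cells /Ptab /RS.
suff H T Q i : cells_from T (rcons w x) =
   rcons (cells_from T w) (ins x (RS_aux w T Q i).1).2 by apply: H.
elim: w T Q i => [|y w IH] T Q i //=.
by case: (ins y T) => T' k /=; rewrite -IH.
Qed.

Lemma size_cells w : size (cells w) = size w.
Proof. by elim/last_ind: w => // w x IH; rewrite cells_rcons !size_rcons IH. Qed.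

Lemma tword_perm_ins x T : perm_eq (tword (ins x T).1) (x :: tword T).
Proof.
elim: T x => [|row T IH] x //; rewrite ins_cons.
have := ins_row_perm x row.
case: (ins_row x row) => [[y|] row'] /= /permP hp; rewrite !tword_cons.
  apply/permP => a; have /permP/(_ a) := IH y; have := hp a.
  by rewrite /= !count_cat; lia.
by apply/permP => a; have := hp a; rewrite /= !count_cat; lia.
Qed.

Lemma tword_perm w : perm_eq (tword (Ptab w)) w.
Proof.
elim/last_ind: w => // w x IH; rewrite Ptab_rcons.
rewrite (perm_trans (tword_perm_ins x _)) // perm_sym perm_rcons perm_cons.
by rewrite perm_sym.
Qed.

Lemma ins_rows_sorted x T : all (sorted leq) T -> all (sorted leq) (ins x T).1.
Proof.
elim: T x => [|row T IH] x //; rewrite ins_cons => /andP[hr hT].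
have := ins_row_sorted x hr.
by case: (ins_row x row) => [[y|] row'] /= ->; rewrite ?IH.
Qed.

Lemma Ptab_rows_sorted w : all (sorted leq) (Ptab w).
Proof. by elim/last_ind: w => // w x IH; rewrite Ptab_rcons ins_rows_sorted. Qed.

(** [raise_rcons] and [ins_crystal] branch on the same test because w and its P-tableau have equal
    [eps]; hence raising commutes with P and moves no new cell. *)
Lemma Ptab_crystal r w :
  [/\ eps r (tword (Ptab w)) = eps r w, phi r (tword (Ptab w)) = phi r w,
      Ptab (raise r w) = traise r (Ptab w) & cells (raise r w) = cells w].
Proof.
elim/last_ind: w => // w x [IHe IHp IHP IHc].
have [he hp hr] := ins_crystal r x (Ptab_rows_sorted w).
rewrite Ptab_rcons he hp raise_rcons !eps_rcons !phi_rcons IHe IHp; split => //.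
  by move: hr; rewrite IHe; case: ifP => _ hr; rewrite Ptab_rcons ?IHP hr.
by move: hr; rewrite IHe; case: ifP => _ hr; rewrite !cells_rcons ?IHc ?IHP hr.
Qed.

Lemma ins_bound x T : (ins x T).2 <= size T.
Proof.
elim: T x => [|row T IH] x //; rewrite ins_cons.
by case: (ins_row x row) => [[y|] row'] //=; apply: IH.
Qed.

Lemma size_ins_row x row :
  size (ins_row x row).2 = size row + ((ins_row x row).1 == None).
Proof.
elim: row => //= z row IH; case: ifP => _ /=; first by rewrite addn0.
by case: (ins_row x row) IH => [[y|] r] /= ->.
Qed.

Lemma shape_ins x T : shape (ins x T).1 = incr_nth (shape T) (ins x T).2.
Proof.
elim: T x => [|row T IH] x //; rewrite ins_cons.
have := size_ins_row x row.
case: (ins_row x row) => [[y|] row'] /= ->; first by rewrite IH addn0.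
by rewrite addn1.
Qed.

Lemma shape_Ptab_rcons w x :
  shape (Ptab (rcons w x)) = incr_nth (shape (Ptab w)) (ins x (Ptab w)).2.
Proof. by rewrite Ptab_rcons shape_ins. Qed.

Lemma shape_cells w : shape (Ptab w) = foldl incr_nth [::] (cells w).
Proof.
elim/last_ind: w => // w x IH.
by rewrite shape_Ptab_rcons cells_rcons -cats1 foldl_cat -IH.
Qed.

(** Needed to invert insertion: inserting into no row and into an empty row gives the same tableau
    and the same row index. *)
Definition rows_nonempty (T : tableau) := all (fun r : seq nat => r != [::]) T.

Lemma ins_nonempty x T : rows_nonempty T -> rows_nonempty (ins x T).1.
Proof.
elim: T x => [|row T IH] x //; rewrite ins_cons => /andP[hr hT].
have := size_ins_row x row.
case: (ins_row x row) => [[y|] [|? ?]] //=; rewrite ?addn1 // addn0.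
  by move=> h; case: (row) hr h.
by move=> _; exact: IH.
Qed.

Lemma Ptab_nonempty w : rows_nonempty (Ptab w).
Proof. by elim/last_ind: w => // w x IH; rewrite Ptab_rcons ins_nonempty. Qed.

Lemma ins_row_inj x1 x2 r1 r2 y r : sorted leq r1 -> sorted leq r2 ->
  ins_row x1 r1 = (Some y, r) -> ins_row x2 r2 = (Some y, r) -> x1 = x2 /\ r1 = r2.
Proof.
(* If one insertion bumps the head z1 and the other bumps an equal letter further on, then x' < z1
   lies in the tail s1, whose entries are at least z1. *)
have mixed z1 s1 z2 s2 x x' s : sorted leq (z1 :: s1) -> x < z1 -> z2 <= x' ->
    (Some z1, x :: s1) = (Some y, s) ->
    (let: (b, s') := ins_row x' s2 in (b, z2 :: s')) = (Some y, s) -> False.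
  move=> hs hx hx' [ey es]; have := ins_row_mem x' s2; have := @ins_row_bump x' s2.
  case: (ins_row x' s2) => b s' hb hm [eb es']; subst b y s.
  case: es' => _ es'; subst s'.
  have := hb _ _ erefl; have := allP (order_path_min leq_trans hs) _ hm; lia.
elim: r1 r2 r => [|z1 s1 IH] [|z2 s2] r //= h1 h2.
case: ltnP => hx1; case: ltnP => hx2.
- by case=> <- <- [-> -> ->].
- by move=> e1 e2; case: (mixed _ _ _ _ _ _ _ h1 hx1 hx2 e1 e2).
- by move=> e1 e2; case: (mixed _ _ _ _ _ _ _ h2 hx2 hx1 e2 e1).
case E1: (ins_row x1 s1) => [b1 t1] [eb1 er1]; subst b1 r.
case E2: (ins_row x2 s2) => [b2 t2] [eb2 ez et]; subst b2 z2 t2.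
by case: (IH _ _ (path_sorted h1) (path_sorted h2) E1 E2) => -> ->.
Qed.

Lemma ins_inj x1 x2 T1 T2 : all (sorted leq) T1 -> all (sorted leq) T2 ->
  rows_nonempty T1 -> rows_nonempty T2 -> ins x1 T1 = ins x2 T2 ->
  x1 = x2 /\ T1 = T2.
Proof.
elim: T1 x1 x2 T2 => [|r1 T1 IH] x1 x2 [|r2 T2].
- by move=> _ _ _ _ [->].
- move=> _ _ _ /andP[hr _]; rewrite ins_cons.
  case E: (ins_row x2 r2) => [[y|] r'] => [[] //|[e1 e2]]; move: (ins_row_None E).
  by rewrite -e1; case: r2 hr {E e2} => // ? [].
- move=> _ _ /andP[hr _] _; rewrite ins_cons.
  case E: (ins_row x1 r1) => [[y|] r'] => [[] //|[e1 e2]]; move: (ins_row_None E).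
  by rewrite e1; case: r1 hr {E e2} => // ? [].
move=> /andP[s1 hs1] /andP[s2 hs2] /andP[_ hn1] /andP[_ hn2]; rewrite !ins_cons.
case E1: (ins_row x1 r1) => [[y1|] r1']; case E2: (ins_row x2 r2) => [[y2|] r2'] //.
  case=> er eT ek; subst r2'.
  have [ey ->] : y1 = y2 /\ T1 = T2.
    by apply: IH => //; rewrite [LHS]surjective_pairing [RHS]surjective_pairing eT ek.
  by subst y2; case: (ins_row_inj s1 s2 E1 E2) => -> ->.
case=> er ->; move: (ins_row_None E1) (ins_row_None E2); rewrite er => -> /eqP.
by rewrite eqseq_rcons => /andP[/eqP -> /eqP ->].
Qed.

Lemma RS_inj w1 w2 : Ptab w1 = Ptab w2 -> cells w1 = cells w2 -> w1 = w2.
Proof.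
elim/last_ind: w1 w2 => [|w1 x1 IH] w2; elim/last_ind: w2 => [|w2 x2 _] //.
- by move=> _ /(congr1 size); rewrite cells_rcons size_rcons.
- by move=> _ /(congr1 size); rewrite cells_rcons size_rcons.
rewrite !Ptab_rcons !cells_rcons => hP /eqP; rewrite eqseq_rcons => /andP[/eqP hc /eqP hk].
have [-> hP'] : x1 = x2 /\ Ptab w1 = Ptab w2.
  apply: ins_inj; rewrite ?Ptab_rows_sorted ?Ptab_nonempty //.
  by rewrite [LHS]surjective_pairing [RHS]surjective_pairing hP hk.
by rewrite (IH w2).
Qed.

Lemma size_Qtab w : size (Qtab w) = size (Ptab w).
Proof.
elim/last_ind: w => // w x IH; rewrite Qtab_rcons Ptab_rcons.
rewrite -(size_map size (ins _ _).1) -/(shape _) shape_ins.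
have hk := ins_bound x (Ptab w); move: (ins x (Ptab w)).2 hk => k.
rewrite -IH => hk; have -> : size (incr_nth (shape (Ptab w)) k) = maxn k.+1 (size (Qtab w)).
  by rewrite size_incr_nth size_map IH; case: ltnP; lia.
by elim: (Qtab w) k hk => [|r Q IHQ] [|k] //= hk; rewrite ?IHQ //; lia.
Qed.

Lemma add_at_letters k v Q : perm_eq (flatten (add_at k v Q)) (v :: flatten Q).
Proof.
elim: Q k => [|r Q IH] [|k] //=.
  by apply/permP => a; rewrite /= -cats1 !count_cat /=; lia.
apply/permP => a; have /permP/(_ a) := IH k.
by rewrite /= !count_cat /=; lia.
Qed.

Lemma Qtab_letters w : all (fun v => v <= size w) (flatten (Qtab w)).
Proof.
elim/last_ind: w => // w x IH; rewrite Qtab_rcons size_rcons.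
rewrite (perm_all _ (add_at_letters _ _ _)) /= leqnn /=.
by apply: sub_all IH => v; lia.
Qed.

Lemma Qtab_nonempty w : rows_nonempty (Qtab w).
Proof.
elim/last_ind: w => // w x IH; rewrite Qtab_rcons.
elim: (Qtab w) (ins _ _).2 IH => [|r Q IHQ] [|k] //= /andP[hr hQ].
  by rewrite /rows_nonempty /= -size_eq0 size_rcons.
by rewrite /rows_nonempty /= hr; apply: IHQ.
Qed.

Lemma add_at_inj v k1 k2 Q1 Q2 : k1 <= size Q1 -> k2 <= size Q2 ->
  rows_nonempty Q1 -> rows_nonempty Q2 ->
  v \notin flatten Q1 -> v \notin flatten Q2 ->
  add_at k1 v Q1 = add_at k2 v Q2 -> k1 = k2 /\ Q1 = Q2.
Proof.
elim: Q1 k1 k2 Q2 => [|r1 Q1 IH] [|k1] [|k2] [|r2 Q2] //=.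
- by move=> _ _ _ /andP[+ _] _ _; case: r2 => // ? [].
- move=> _ _ _ /andP[hr _] _; rewrite mem_cat negb_or => /andP[+ _] [e _].
  by rewrite -e mem_head.
- by move=> _ _ /andP[+ _]; case: r1 => // ? [].
- by move=> _ _ _ _ _ _ [/rcons_inj [->] ->].
- move=> _ _ _ _ _; rewrite mem_cat negb_or => /andP[+ _] [e _].
  by rewrite -e mem_rcons mem_head.
- move=> _ _ _ _ + _ [e _]; rewrite mem_cat negb_or => /andP[+ _].
  by rewrite e mem_head.
- move=> _ _ _ _ + _ [e _]; rewrite mem_cat negb_or => /andP[+ _].
  by rewrite e mem_rcons mem_head.
move=> h1 h2 /andP[_ n1] /andP[_ n2].
rewrite !mem_cat !negb_or => /andP[_ v1] /andP[_ v2] [-> e].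
by case: (IH k1 k2 Q2 h1 h2 n1 n2 v1 v2 e) => -> ->.
Qed.

(** The label added at each step is larger than all earlier ones, so its row can be read off from
    the recording tableau. *)
Lemma Qtab_cells w1 w2 : Qtab w1 = Qtab w2 <-> cells w1 = cells w2.
Proof.
elim/last_ind: w1 w2 => [|w1 x1 IH] w2; elim/last_ind: w2 => [|w2 x2 _] //.
- split=> [/(congr1 size)|/(congr1 size)]; last by rewrite cells_rcons size_rcons.
  by rewrite Qtab_rcons; case: (Qtab w2) (ins _ _).2 => [|? ?] [].
- split=> [/(congr1 size)|/(congr1 size)]; last by rewrite cells_rcons size_rcons.
  by rewrite Qtab_rcons; case: (Qtab w1) (ins _ _).2 => [|? ?] [].
rewrite !Qtab_rcons !cells_rcons; split; last first.
  move=> /rcons_inj [hc ->]; rewrite (IH w2).2 //.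
  by rewrite -(size_cells w1) hc size_cells.
have szQ w : size (flatten (Qtab w)) = size w.
  elim/last_ind: w => // w x IHw.
  by rewrite Qtab_rcons size_rcons -IHw; exact: (perm_size (add_at_letters _ _ _)).
move=> e; have es : size w1 = size w2.
  move/(congr1 (fun Q => size (flatten Q))): (e).
  by rewrite !(perm_size (add_at_letters _ _ _)) /= !szQ => -[].
move: e; rewrite es => /add_at_inj [||||||-> /IH -> //];
  rewrite ?size_Qtab ?ins_bound ?Qtab_nonempty //; apply/negP => /(allP (Qtab_letters _)); lia.
Qed.

(** * Column-strict tableaux and Knuth equivalence *)

(** Unlike [cols_ok], this also compares the lengths of the rows, so that column strictness becomes
    a plain recursion over adjacent rows. *)
Fixpoint dom (r1 r2 : seq nat) : bool :=
  match r1, r2 with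
  | _, [::] => true
  | a :: r1', b :: r2' => (a < b) && dom r1' r2'
  | [::], _ :: _ => false
  end.

Fixpoint cstrict (T : tableau) : bool :=
  if T is r :: T' then
    [&& r != [::], sorted leq r, dom r (head [::] T') & cstrict T']
  else true.

Lemma dom_nil r : dom r [::].
Proof. by case: r. Qed.

Lemma domE r1 r2 : dom r1 r2 =
  (size r2 <= size r1) && all (fun j => nth 0 r1 j < nth 0 r2 j) (iota 0 (size r2)).
Proof.
elim: r1 r2 => [|a r1 IH] [|b r2] //=.
rewrite IH ltnS -[1]addn1 (iotaDl 1 0) all_map andbCA; congr (_ && (_ && _)).
Qed.

Lemma column_strictE T : column_strict T = cstrict T.
Proof.
elim: T => // r T IH; rewrite /= -IH /column_strict /= domE -size_eq0 -lt0n.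
case: T {IH} => [|s T] /=; first by rewrite !andbT.
by do ?[case: (_ < size _) => //=]; case: (sorted leq r) => //=; rewrite ?andbF //;
  case: (size s <= size r) => //=; rewrite ?andbF //;
  case: (all _ (iota _ _)) => //=; rewrite ?andbF //.
Qed.

Lemma dom_ins_row_weak x row y row' s :
  ins_row x row = (Some y, row') -> dom row s -> dom row' s.
Proof.
elim: row row' s => //= z row IH row' [|b s].
  by rewrite dom_nil.
case: ltnP => hx; first by case=> _ <- /= /andP[hz ->]; rewrite andbT; lia.
case E: (ins_row x row) => [b' r] [eb <-] /= /andP[-> hd] /=.
by apply: (IH r s) => //; rewrite E eb.
Qed.

Lemma dom_rcons r x s : dom r s -> dom (rcons r x) s.
Proof. by elim: r s => [|a r IH] [|b s] //= /andP[-> /IH]. Qed.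

(** The entry below y, if there is one, exceeds y, so y enters the next row weakly to the left of
    its old column. The entries of row' up to that column are at most x, hence smaller than y. *)
Lemma dom_ins_row x row y row' s : ins_row x row = (Some y, row') ->
  dom row s -> dom row' (ins_row y s).2.
Proof.
elim: row row' s => //= z row IH row' s.
case: ltnP => hx.
  case=> <- <-; case: s => [|b s] /=; first by rewrite hx dom_nil.
  by move=> /andP[hzb hd]; rewrite hzb /= hx hd.
case E: (ins_row x row) => [b' r] [eb <-]; subst b'.
have hxy := ins_row_bump E.
case: s => [|b s] /=; first by rewrite dom_nil andbT => _; lia.
move=> /andP[hzb hd]; case: ltnP => hyb /=.
  by rewrite (dom_ins_row_weak E hd) andbT; lia.
by have := IH _ _ E hd; case: (ins_row y s) => b' s' /= ->; rewrite hzb.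
Qed.

Lemma head_ins x T : head [::] (ins x T).1 = (ins_row x (head [::] T)).2.
Proof.
by case: T => // row T; rewrite ins_cons; case: (ins_row x row) => [[y|] r].
Qed.

Lemma ins_cstrict x T : cstrict T -> cstrict (ins x T).1.
Proof.
elim: T x => [|row T IH] x //; rewrite ins_cons => /= /and4P[h1 h2 h3 h4].
have := ins_row_sorted x h2; have := size_ins_row x row.
case E: (ins_row x row) => [[y|] row'] /= hs -> /=.
  rewrite head_ins (dom_ins_row E h3) IH // !andbT.
  by rewrite -size_eq0 hs addn0 size_eq0.
rewrite (ins_row_None E) dom_rcons // h4 !andbT.
by rewrite -size_eq0 size_rcons.
Qed.

Lemma Ptab_cstrict w : cstrict (Ptab w).
Proof. by elim/last_ind: w => // w x IH; rewrite Ptab_rcons ins_cstrict. Qed.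

Lemma dom_size r s : dom r s -> size s <= size r.
Proof. by rewrite domE => /andP[]. Qed.

Lemma cstrict_shape T j : cstrict T -> nth 0 (shape T) j.+1 <= nth 0 (shape T) j.
Proof.
elim: T j => [|r T IH] [|j] //= /and4P[_ _ hd /IH]; last by apply.
by case: T hd {IH} => [|s T] //= /dom_size.
Qed.

Lemma cstrict_nth T j : cstrict T -> dom (nth [::] T j) (nth [::] T j.+1).
Proof.
elim: T j => [|r T IH] [|j] //= /and4P[_ _ hd /IH]; last by apply.
by case: T hd {IH}.
Qed.

Lemma cstrict_drop j T : cstrict T -> cstrict (drop j T).
Proof. by elim: j T => [|j IH] [|r T] //= /and4P[_ _ _ /IH]. Qed.

Lemma dom_all_gt c r s : dom r s -> all (leq c) r -> all (leq c.+1) s.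
Proof.
elim: r s => [|a r IH] [|b s] //= /andP[hab hd] /andP[ha hr].
by rewrite (IH s) // andbT; lia.
Qed.

Lemma dom_count_le y r s : dom r s ->
  count (fun x => x <= y.+1) s <= count (fun x => x <= y) r.
Proof.
elim: r s => [|a r IH] [|b s] //= /andP[hab /IH]; lia.
Qed.

Lemma cstrict_below c r T : cstrict (r :: T) -> all (leq c) r -> all (leq c.+1) (tword T).
Proof.
elim: T r c => // s T IH r c /= /and4P[_ _ hd hT] hr.
have hs := dom_all_gt hd hr.
rewrite tword_cons all_cat hs andbT; move: (IH s c.+1 hT hs).
by apply: sub_all => x; lia.
Qed.

Definition knuth_refl := rst_refl word knuth_step.
Definition knuth_sym := rst_sym word knuth_step.
Definition knuth_trans := rst_trans word knuth_step.

Lemma knuth_cat a b u v : knuth_equiv u v -> knuth_equiv (a ++ u ++ b) (a ++ v ++ b).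
Proof.
elim=> {u v} [u v [c d x y z h1 h2|c d x y z h1 h2]|u|u v _ IH|u v w _ IH1 _ IH2].
- have := knuth_xzy (a ++ c) (d ++ b) h1 h2; rewrite -!catA; exact: rst_step.
- have := knuth_yxz (a ++ c) (d ++ b) h1 h2; rewrite -!catA; exact: rst_step.
- exact: knuth_refl.
- exact: knuth_sym.
- exact: knuth_trans IH1 IH2.
Qed.

Lemma knuth_catl a u v : knuth_equiv u v -> knuth_equiv (a ++ u) (a ++ v).
Proof. by move=> h; have := knuth_cat a [::] h; rewrite !cats0. Qed.

Lemma knuth_catr b u v : knuth_equiv u v -> knuth_equiv (u ++ b) (v ++ b).
Proof. exact: (@knuth_cat [::]). Qed.

Lemma knuth_shift_left x z row : sorted leq (z :: row) -> x < z ->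
  knuth_equiv (rcons (z :: row) x) (z :: x :: row).
Proof.
elim: row z => [|y row IH] z; first by move=> _ _; exact: knuth_refl.
move=> /= /andP[hzy hs] hx.
apply: knuth_trans (@knuth_catl [:: z] _ _ (IH y hs _)) _; first exact: leq_trans hzy.
by apply/knuth_sym/rst_step; apply: (@knuth_yxz [::] row).
Qed.

(** First x moves left past the larger entries, then the bumped y moves left past the smaller ones;
    each move is one Knuth relation. *)
Lemma knuth_ins_row x row : sorted leq row ->
  knuth_equiv (rcons row x) (seq_of_opt (ins_row x row).1 ++ (ins_row x row).2).
Proof.
elim: row => [|z row IH] h; first exact: knuth_refl.
have hz := order_path_min leq_trans h.
have := IH (path_sorted h); have := ins_row_all (leq z) x row.
have := @ins_row_bump x row; have := ins_row_sorted x (path_sorted h).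
have := ins_row_mem x row; rewrite hz /=.
case: ltnP => hx /=; first by move=> *; apply: knuth_shift_left.
case: (ins_row x row) => [[y|] row'] /= hm hs ha hb hk; last exact: (@knuth_catl [:: z]).
apply: knuth_trans (@knuth_catl [:: z] _ _ hk) _ => /=.
case: row' hm hs ha hb {hk} => // c s hm hs ha /andP[_ /andP[hc _]].
have hxy := ha _ _ erefl.
(* The head c of row' satisfies z <= c <= x < y, since x itself is an entry of the sorted row'. *)
apply/rst_step/(@knuth_xzy [::] s) => //.
apply: leq_ltn_trans hxy; move: hm; rewrite inE => /orP[/eqP -> //|].
by move/(allP (order_path_min leq_trans hs)).
Qed.

Lemma knuth_ins x T : all (sorted leq) T ->
  knuth_equiv (rcons (tword T) x) (tword (ins x T).1).
Proof.
elim: T x => [|row T IH] x; first by move=> _; exact: knuth_refl.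
move=> /andP[hr hT]; rewrite ins_cons tword_cons rcons_cat.
apply: knuth_trans (knuth_catl _ (knuth_ins_row x hr)) _.
case: (ins_row x row) => [[y|] row'] /=; rewrite tword_cons; last exact: knuth_refl.
by rewrite -cat_rcons; apply/knuth_catr/IH.
Qed.

Lemma knuth_Ptab w : knuth_equiv w (tword (Ptab w)).
Proof.
elim/last_ind: w => [|w x IH]; first exact: knuth_refl.
rewrite Ptab_rcons; apply: knuth_trans _ (knuth_ins x (Ptab_rows_sorted w)).
by rewrite -!cats1; apply: knuth_catr.
Qed.

Lemma knuth_perm u v : knuth_equiv u v -> perm_eq u v.
Proof.
elim=> {u v} [u v [a b x y z _ _|a b x y z _ _]|u|u v _|u v w _ h1 _]; rewrite //.
- by apply/permP => p; rewrite !count_cat /=; lia.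
- by apply/permP => p; rewrite !count_cat /=; lia.
- by rewrite perm_sym.
- exact: perm_trans.
Qed.

Lemma knuth_crystal r u v : knuth_equiv u v ->
  eps r u = eps r v /\ phi r u = phi r v.
Proof.
elim=> {u v} [u v h|//|u v _ [-> ->] //|u v w _ [-> ->] _ [-> ->] //].
have ctx a b u' v' : eps r u' = eps r v' /\ phi r u' = phi r v' ->
    eps r (a ++ u' ++ b) = eps r (a ++ v' ++ b) /\ phi r (a ++ u' ++ b) = phi r (a ++ v' ++ b).
  by case=> he hp; rewrite !eps_cat !phi_cat he hp.
case: h => a b x y z h1 h2; apply: ctx => /=.
- case: (x =P r.+1) => ?; case: (y =P r.+1) => ?; case: (z =P r.+1) => ?; try lia;
  case: (x =P r) => ?; case: (y =P r) => ?; case: (z =P r) => ? /=; lia.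
- case: (x =P r.+1) => ?; case: (y =P r.+1) => ?; case: (z =P r.+1) => ?; try lia;
  case: (x =P r) => ?; case: (y =P r) => ?; case: (z =P r) => ? /=; lia.
Qed.

(* yam a [:: m1; m2; ...] has m1 copies of a+1 in its first row, m2 copies of
   a+2 in its second row, and so on. *)
Fixpoint yam (a : nat) (s : seq nat) : tableau :=
  if s is m :: s' then nseq m a.+1 :: yam a.+1 s' else [::].

(** The first row is read last, so an entry x > a+1 in it would be an unmatched r+1 for r = x-1.
    Hence this row is constant and contains none of the letters r > a+1 that could match a letter of
    the rows below. *)
Lemma yam_of_eps0 a T : cstrict T -> all (ltn a) (tword T) ->
  (forall r, a < r -> eps r (tword T) = 0) -> T = yam a (shape T).
Proof.
elim: T a => // row T IH a hcs; rewrite tword_cons all_cat => /andP[_ hrow] he.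
have /and4P[hn hs hd hT] := hcs.
have er : row = nseq (size row) a.+1.
  apply/all_pred1P/allP => x hx; have hax := allP hrow _ hx; rewrite /= in hax.
  case: (ltngtP x a.+1) => [|h|->]; [by lia| |exact: eqxx].
  have := he x.-1; rewrite eps_cat (eps_sorted _ hs) prednK; last lia.
  have : 0 < count_mem x row by rewrite -has_count has_pred1.
  by lia.
have hT1 := cstrict_below hcs hrow.
rewrite /= -er -IH // => r hr; have := he r; rewrite eps_cat (phi_sorted _ hs).
have -> : count_mem r row = 0.
  by rewrite er count_nseq /= (ltn_eqF hr).
lia.
Qed.

Lemma yam_letters a s : all (ltn a) (tword (yam a s)).
Proof.
elim: s a => // m s IH a; rewrite [yam _ _]/= tword_cons all_cat all_nseq /= ltnSn orbT andbT.
by apply: sub_all (IH a.+1) => x /= ; lia.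
Qed.

Lemma count_yam a s d : count_mem (a.+1 + d) (tword (yam a s)) = nth 0 s d.
Proof.
elim: s a d => [|m s IH] a d; first by rewrite nth_nil.
rewrite [yam _ _]/= tword_cons count_cat count_nseq /=.
case: d => [|d] /=; last by rewrite addnS -addSn IH (ltn_eqF (leq_addr _ _)) // ; lia.
rewrite addn0 eqxx mul1n -[RHS]add0n; congr (_ + _).
by apply/count_memPn/negP => /(allP (yam_letters _ _)); rewrite /= ltnn.
Qed.

Lemma ltn_sumn_raise r u : 0 < eps r u -> sumn (raise r u) < sumn u.
Proof. by move=> h; rewrite -(sumn_raise h). Qed.

(* Induction along raising chains: every word can be raised to a highest
   weight word. *)
Lemma raise_ind (P : word -> Prop) :
  (forall h, all (ltn 0) h -> (forall r, 0 < r -> eps r h = 0) -> P h) ->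
  (forall r w, all (ltn 0) w -> 0 < r -> 0 < eps r w -> P (raise r w) -> P w) ->
  forall w, all (ltn 0) w -> P w.
Proof.
move=> Phigh Pstep w; move: {2}(sumn w) (leqnn (sumn w)) => m.
elim: m w => [|m IH] w hm hw.
  apply: Phigh => // r hr; apply/eqP; rewrite -leqn0 -ltnS.
  case: (posnP (eps r w)) => [->//|h]; move: (ltn_sumn_raise h); lia.
(* A positive [eps r w] requires the letter r+1 in w, so a search through the letters of w decides
   whether some raising applies. *)
case hx: (has (fun x => (1 < x) && (0 < eps x.-1 w)) w).
  have /hasP [x _ /andP[h1 h2]] := hx.
  apply: (Pstep x.-1) => //; first by lia.
  apply: IH; first by have := ltn_sumn_raise h2; lia.
  by apply: raise_letters => //=; lia.
apply: Phigh => // r hr; apply/eqP; rewrite -leqn0 leqNgt; apply/negP => he.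
have hm1 : r.+1 \in w by rewrite -has_pred1 has_count (leq_trans he) ?eps_count.
by move/hasPn: (negbT hx) => /(_ _ hm1); rewrite /= he ltnS hr.
Qed.

Lemma highest_Ptab h : all (ltn 0) h -> (forall r, 0 < r -> eps r h = 0) ->
  Ptab h = yam 0 (shape (Ptab h)).
Proof.
move=> hh he; apply: yam_of_eps0; first exact: Ptab_cstrict.
  by rewrite (perm_all _ (tword_perm h)).
by move=> r /he; case: (Ptab_crystal r h) => ->.
Qed.

Lemma highest_content h d : all (ltn 0) h -> (forall r, 0 < r -> eps r h = 0) ->
  count_mem d.+1 h = nth 0 (shape (Ptab h)) d.
Proof.
move=> hh he; rewrite -(permP (tword_perm h)) {1}(highest_Ptab hh he).
by rewrite -(count_yam 0) add1n.
Qed.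

Lemma shape_raise r w : shape (Ptab (raise r w)) = shape (Ptab w).
Proof. by rewrite !shape_cells; case: (Ptab_crystal r w) => _ _ _ ->. Qed.

Lemma tword_inj T1 T2 : shape T1 = shape T2 -> tword T1 = tword T2 -> T1 = T2.
Proof.
move=> hs ht; apply: (can_inj (@revK _)); apply: eq_from_flatten_shape => //.
by rewrite /seq.shape !map_rev -!/(shape _) hs.
Qed.

(* Raise w and t to highest weight words, whose P-tableaux agree because the
   shapes do, and then lower back along the chain of t. *)
Lemma RS_surj w t : all (ltn 0) w -> all (ltn 0) t ->
  shape (Ptab w) = shape (Ptab t) -> exists2 u, Ptab u = Ptab t & cells u = cells w.
Proof.
move=> hw; elim/raise_ind: t /; last first.
  move=> r t ht hr he IH; rewrite -(shape_raise r t) => /IH [u hP hc].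
  have [_ hp hPt _] := Ptab_crystal r t.
  have [v hv ev] : exists2 v, 0 < eps r v & raise r v = u.
    apply: raise_surj; have [_ <- _ _] := Ptab_crystal r u.
    by rewrite hP hPt tword_traise phi_raise //; case: (Ptab_crystal r t) => ->.
  have [hve _ hPv hcv] := Ptab_crystal r v.
  exists v; last by rewrite -hcv ev.
  apply: tword_inj.
    by rewrite -(shape_raise r v) -(shape_raise r t) ev hP.
  rewrite -(@raiseK r (tword (Ptab v))) ?hve // -(@raiseK r (tword (Ptab t))).
    by rewrite -!tword_traise -hPv ev hP hPt.
  by case: (Ptab_crystal r t) => ->.
move=> g hg heg; elim/raise_ind: w / hw => [h hh heh hs|r w hw hr he IH].
  by exists h; rewrite // (highest_Ptab hh heh) hs -(highest_Ptab hg heg).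
rewrite -(shape_raise r w) => /IH [u hP hc]; exists u => //.
by rewrite hc; case: (Ptab_crystal r w).
Qed.

(** * Reversal, prepending a letter, and positions of new cells *)

Definition in1n (n : nat) : pred nat := fun x => 1 <= x <= n.

(** Reversal with complement. It exchanges [eps r] with [phi (n - r)], turns raising into lowering,
    and makes prepending a letter an insertion at the end. *)
Definition star (n : nat) (w : word) : word := rev [seq n.+1 - x | x <- w].

Lemma star_cat n u v : star n (u ++ v) = star n v ++ star n u.
Proof. by rewrite /star map_cat rev_cat. Qed.

Lemma star_cons n x w : star n (x :: w) = rcons (star n w) (n.+1 - x).
Proof. by rewrite /star /= rev_cons. Qed.

Lemma star_in1n n w : all (in1n n) w -> all (in1n n) (star n w).
Proof.
by rewrite /star all_rev all_map; apply: sub_all => x; rewrite /in1n /=; lia.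
Qed.

Lemma starK n w : all (in1n n) w -> star n (star n w) = w.
Proof.
move=> hw; rewrite /star map_rev revK -map_comp -[RHS]map_id.
by apply/eq_in_map => x /(allP hw) /=; rewrite /in1n; lia.
Qed.

Lemma count_star n w x : all (in1n n) w -> in1n n x ->
  count_mem x (star n w) = count_mem (n.+1 - x) w.
Proof.
move=> hw hx; rewrite /star count_rev count_map.
by apply/eq_in_count => y /(allP hw) /=; move: hx; rewrite /in1n; lia.
Qed.

Lemma crystal_star n r w : all (in1n n) w -> r <= n ->
  eps (n - r) (star n w) = phi r w /\ phi (n - r) (star n w) = eps r w.
Proof.
move=> hw hr; elim: w hw => //= x w IH /andP[hx /IH [he hp]].
rewrite star_cons eps_rcons phi_rcons he hp; move: hx; rewrite /in1n => hx.
have -> : (n.+1 - x == (n - r).+1) = (x == r) by lia.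
have -> : (n.+1 - x == n - r) = (x == r.+1) by lia.
by case: (x =P r.+1) => ?; case: (x =P r) => ? /=; lia.
Qed.

Lemma raise_star n r w : all (in1n n) w -> r <= n -> 0 < eps r w ->
  raise (n - r) (star n (raise r w)) = star n w.
Proof.
move=> hw hr /raiseP [p [q [ew hp hq ->]]].
move: hw; rewrite ew all_cat => /and3P[wp _ wq].
rewrite !star_cat !star_cons subSn // -!cats1 -!catA raise_at.
- by [].
- by have [-> _] := crystal_star wq hr.
- by have [_ ->] := crystal_star wp hr.
Qed.

Lemma cstrict_count_le T y k : cstrict T ->
  count (fun x => x <= y + k) (nth [::] T k) <= count (fun x => x <= y) (nth [::] T 0).
Proof.
elim: k y => [|k IH] y hT; first by rewrite addn0.
rewrite addnS; apply: leq_trans (dom_count_le _ (cstrict_nth k hT)) _.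
exact: IH.
Qed.

(* A letter > n-k in row i has no cell k rows below it, so row i contains at
   most shape_i - shape_(i+k) of them; these bounds telescope. *)
Lemma count_large n k T : cstrict T -> all (geq n) (tword T) ->
  count (fun x => n - k < x) (tword T) <= sumn (take k (shape T)).
Proof.
elim: T => // row T IH hcs; rewrite tword_cons all_cat => /andP[hT hrow].
have hcT : cstrict T by case/and4P: hcs.
rewrite count_cat; case: k IH => [|k] IH.
  rewrite subn0 take0 leqn0 addn_eq0.
  apply/andP; split; rewrite -leqn0 leqNgt -has_count; apply/hasPn => x.
    by move/(allP hT) => /=; lia.
  by move/(allP hrow) => /=; lia.
have h1 := IH hcT hT.
have h2 := cstrict_count_le (n - k.+1) k.+1 hcs.
have h3 := count_predC (fun x => x <= n - k.+1) row.
have h4 : count (fun x => n - k.+1 < x) row = count (predC (fun x => x <= n - k.+1)) row.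
  by apply: eq_count => x /=; rewrite ltnNge.
have h5 : size (nth [::] T k) <= count (fun x => x <= n - k.+1 + k.+1) (nth [::] T k).
  rewrite leq_eqVlt eq_sym -all_count; apply/orP; left.
  case: (ltnP k (size T)) => hk; last by rewrite nth_default.
  apply/allP => x hx; have : x \in tword T.
    by apply/flattenP; exists (nth [::] T k) => //; rewrite mem_rev mem_nth.
  by move/(allP hT) => /=; lia.
have h6 : sumn (take k.+1 (shape T)) = sumn (take k (shape T)) + size (nth [::] T k).
  case: (ltnP k (size T)) => hk.
    by rewrite (take_nth 0) ?size_map // sumn_rcons (nth_map [::]).
  by rewrite !take_oversize ?size_map // ?(leqW hk) // nth_default // addn0.
move: h2 h1; rewrite /= h6; lia.
Qed.

Lemma shape_pos T : cstrict T -> all (ltn 0) (shape T).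
Proof. by elim: T => //= r T IH /and4P[h _ _ /IH ->]; rewrite andbT lt0n size_eq0. Qed.

Lemma eq_from_sumn_take s t : all (ltn 0) s -> all (ltn 0) t ->
  (forall k, sumn (take k s) = sumn (take k t)) -> s = t.
Proof.
elim: s t => [|m s IH] [|m' t] //.
- by move=> _ /andP[/= h _] /(_ 1) /=; rewrite take0 /=; lia.
- by move=> /andP[/= h _] _ /(_ 1) /=; rewrite take0 /=; lia.
move=> /andP[_ hs] /andP[_ ht] h.
have em : m = m' by have := h 1; rewrite /= !take0 /=; lia.
by rewrite em (IH t) // => k; have := h k.+1; rewrite /= em; lia.
Qed.

Lemma in1n_gt0 n w : all (in1n n) w -> all (ltn 0) w.
Proof. by apply: sub_all => x /andP[]. Qed.

(** By [raise_star], raising w keeps the shapes on both sides, so w may be taken of highest weight.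
    Then the left-hand side counts the letters at most k; [star] makes them the letters above n-k,
    which [count_large] bounds. *)
Lemma shape_star_le n w k : all (in1n n) w ->
  sumn (take k (shape (Ptab w))) <= sumn (take k (shape (Ptab (star n w)))).
Proof.
move=> hw; move: hw (in1n_gt0 hw) => /[swap]; elim/raise_ind => {w}; last first.
  move=> r w _ hr he IH hw.
  have hrn : r < n.
    have : r.+1 \in w by rewrite -has_pred1 has_count (leq_trans he) ?eps_count.
    by move/(allP hw)/andP=> [].
  rewrite -(shape_raise r w) -(raise_star hw (ltnW hrn) he) (shape_raise (n - r)); apply: IH.
  by apply: raise_letters => //; rewrite /in1n; lia.
move=> h h0 he hn.
have hP := highest_Ptab h0 he.
suff -> : sumn (take k (shape (Ptab h))) =
    count (fun x => n - k < x) (tword (Ptab (star n h))).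
  apply: count_large; first exact: Ptab_cstrict.
  rewrite (perm_all _ (tword_perm _)).
  by apply: sub_all (star_in1n hn) => x /andP[].
rewrite (permP (tword_perm _)) /star count_rev count_map.
transitivity (count (fun x => x <= k) h); last first.
  by apply/eq_in_count => y /(allP hn) /=; rewrite /in1n; lia.
elim: k => [|k IH].
  rewrite take0; apply/esym/eqP; rewrite -leqn0 leqNgt -has_count.
  by apply/hasPn => x /(allP h0) /=; lia.
have -> : count (fun x => x <= k.+1) h = count (fun x => x <= k) h + count_mem k.+1 h.
  rewrite -count_predUI -[LHS]addn0; congr (_ + _).
    by apply: eq_count => x /=; lia.
  by apply/esym/eqP; rewrite -leqn0 leqNgt -has_count; apply/hasPn => x _ /=; lia.
rewrite (highest_content k h0 he) -IH.
case: (ltnP k (size (shape (Ptab h)))) => hk.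
  by rewrite (take_nth 0) // sumn_rcons.
by rewrite !take_oversize // ?(leqW hk) // nth_default // addn0.
Qed.

Lemma shape_star n w : all (in1n n) w -> shape (Ptab (star n w)) = shape (Ptab w).
Proof.
move=> hw; apply: eq_from_sumn_take; try exact/shape_pos/Ptab_cstrict.
move=> k; apply/eqP; rewrite eqn_leq shape_star_le // andbT.
by have := shape_star_le k (star_in1n hw); rewrite starK.
Qed.

Lemma raise_cons_cases r x v : 0 < eps r (x :: v) ->
  raise r (x :: v) = r :: v \/ raise r (x :: v) = x :: raise r v /\ 0 < eps r v.
Proof.
rewrite /=; case: (x =P r.+1) => /= _; last by right.
by case: eqP => /= _; [left|rewrite addn0; right].
Qed.

(** Each raising changes either the first letter alone or v alone, and in both cases [cells v] is
    kept. *)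
Lemma cells_cons_raised y v : all (ltn 0) (y :: v) ->
  exists y0 v0, [/\ all (ltn 0) (y0 :: v0), cells v0 = cells v,
    cells (y0 :: v0) = cells (y :: v) &
    forall r, 0 < r -> eps r (y0 :: v0) = 0].
Proof.
move e: (y :: v) => w hw; elim/raise_ind: w / hw y v e.
  by move=> h h0 he y v e; exists y, v; rewrite e; split.
move=> r w h0 hr he IH y v e; move: he; rewrite -e => he.
have hc : cells (raise r w) = cells (y :: v) by rewrite -e; case: (Ptab_crystal r (y :: v)).
case: (raise_cons_cases he) => [hy|[hy _]]; rewrite e in hy.
  by have [y0 [v0 [h1 h2 h3 h4]]] := IH _ _ (esym hy); exists y0, v0; split=> //; rewrite h3 hc.
have [y0 [v0 [h1 h2 h3 h4]]] := IH _ _ (esym hy); exists y0, v0; split=> //.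
  by rewrite h2; case: (Ptab_crystal r v).
by rewrite h3 hc.
Qed.

(* Raising y v to a highest weight word y0 v0 makes the suffix v0 highest, so
   v0 depends only on the recording data of v, and y0 only on the shapes. *)
Lemma cells_cons y1 v1 y2 v2 : all (ltn 0) (y1 :: v1) -> all (ltn 0) (y2 :: v2) ->
  cells v1 = cells v2 -> shape (Ptab (y1 :: v1)) = shape (Ptab (y2 :: v2)) ->
  cells (y1 :: v1) = cells (y2 :: v2).
Proof.
move=> h1 h2 hc hs.
have [z1 [u1 [p1 c1 d1 e1]]] := cells_cons_raised h1.
have [z2 [u2 [p2 c2 d2 e2]]] := cells_cons_raised h2.
rewrite -d1 -d2; have [/= /andP[_ q1] /andP[_ q2]] := (p1, p2).
have f1 r : 0 < r -> eps r u1 = 0 by move/e1 => /=; case: eqP; lia.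
have f2 r : 0 < r -> eps r u2 = 0 by move/e2 => /=; case: eqP; lia.
have eu : u1 = u2.
  apply: RS_inj; last by rewrite c1 c2.
  by rewrite (highest_Ptab q1 f1) (highest_Ptab q2 f2) !shape_cells c1 c2 hc.
(* The content of a highest weight word is its shape, so equal shapes and equal suffixes force z1 =
   z2. *)
have cz d : count_mem d.+1 (z1 :: u1) = count_mem d.+1 (z2 :: u2).
  by rewrite !highest_content // !shape_cells d1 d2 -!shape_cells hs.
suff -> : z1 = z2 by rewrite eu.
move: p1 (cz z1.-1) => /= /andP[hz1 _]; rewrite prednK // eqxx eu.
by case: (z2 =P z1) => // _; lia.
Qed.

(** The letters bumped from row to row strictly increase and never exceed n. *)
Lemma ins_row_index n x T : all (geq n) (tword T) -> x <= n -> x + (ins x T).2 <= n.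
Proof.
elim: T x => [|row T IH] x hT hx; first by rewrite addn0.
rewrite ins_cons; move: hT; rewrite tword_cons all_cat => /andP[hT hrow].
have := @ins_row_bump x row; have := ins_row_all (geq n) x row.
rewrite hrow /= hx; case: (ins_row x row) => [[y|] r] /=; last by rewrite addn0.
move=> /andP[hy _] /(_ _ _ erefl) hxy; have := IH y hT hy; lia.
Qed.

Lemma ins_row_None_le x row row' :
  ins_row x row = (None, row') -> all (fun z => z <= x) row.
Proof.
elim: row row' => //= z row IH row'; case: ltnP => // hx.
by case E: (ins_row x row) => [b r] [eb _]; subst b; rewrite (IH _ E).
Qed.

(** The counts are the columns where y enters s and where x enters [row], and the entry of s below
    y, if any, exceeds y: the bumping path moves weakly to the left. *)
Lemma ins_row_path_left x row y row' s : sorted leq row -> sorted leq s -> dom row s ->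
  ins_row x row = (Some y, row') ->
  count (fun z => z <= y) s <= count (fun z => z <= x) row.
Proof.
elim: row s row' => [|z row IH] [|b s] row' //= hs hbs /andP[hzb hd].
case: ltnP => hx.
  case=> ey _; subst y; rewrite (leqNgt b z) hzb /= add0n.
  suff -> : count (fun c => c <= z) s = 0 by [].
  apply/eqP; rewrite -leqn0 leqNgt -has_count; apply/hasPn => c.
  by move/(allP (order_path_min leq_trans hbs)); lia.
case E: (ins_row x row) => [b' r] [eb _]; subst b'.
have := IH s _ (path_sorted hs) (path_sorted hbs) hd E.
by case: (b <= y) => /=; lia.
Qed.

(** The left-hand side is the column of the new cell, at the end of a path that moves weakly to the
    left from the column where x enters. *)
Lemma ins_col_index x T : cstrict T ->
  nth 0 (shape T) (ins x T).2 <= count (fun z => z <= x) (head [::] T).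
Proof.
elim: T x => [|row T IH] x // /and4P[_ hs hd hT]; rewrite ins_cons.
case E: (ins_row x row) => [[y|] r] /=.
  apply: leq_trans (IH y hT) _; apply: ins_row_path_left hd E => //.
  by case: (T) hT => //= ? ? /and4P[].
by move: (ins_row_None_le E); rewrite all_count => /eqP ->.
Qed.

(** * Littlewood-Richardson words *)

(* For rectangular content, being Knuth equivalent to the highest weight word
   of A_i amounts to having every r+1 matched for r, r+1 in A_i. *)
Definition lattice (R : seq (nat * nat)) (w : word) : Prop :=
  all (in1n (ntot R)) w /\
  forall i, 1 <= i <= size R ->
    (forall x, inA R i x -> count_mem x w = mu R i) /\
    (forall r, inA R i r -> inA R i r.+1 -> eps r w = 0).

Lemma Ytab_yam R i : Ytab R i = yam (off R i) (nseq (eta R i) (mu R i)).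
Proof.
rewrite /Ytab; move: (eta R i) (mu R i) (off R i) => h m a.
elim: h a => //= h IH a; rewrite addn1 -IH; congr (_ :: _).
rewrite -[2]addn1 (iotaDl 1 1) -map_comp; apply: eq_map => j /=.
by congr (nseq m _); lia.
Qed.

Lemma eps_rect a h m r : a < r -> eps r (tword (yam a (nseq h m))) = 0.
Proof.
elim: h a => // h IH a ha; rewrite [yam _ _]/= tword_cons eps_cat.
have hs : sorted leq (nseq m a.+1) by elim: m {IH} => // [[|m]] //= ->; rewrite leqnn.
rewrite eps_sorted // phi_sorted // !count_nseq /= eqSS (ltn_eqF ha) /= add0n.
case: (eqVneq a.+1 r) => [<-|ne]; last by rewrite IH //; lia.
rewrite mul1n; apply/eqP; rewrite subn_eq0; apply: leq_trans (eps_count _ _) _.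
have := count_yam a.+1 (nseq h m) 0; rewrite addn0 => ->.
by case: (h).
Qed.

Lemma count_filter_in (B : pred nat) x w : B x -> count_mem x (filter B w) = count_mem x w.
Proof.
move=> hB; rewrite count_filter; apply: eq_count => y /=.
by case: eqP => // ->; rewrite hB.
Qed.

(** The subword z is of highest weight: inside the block by hypothesis, beyond it because no larger
    letter occurs. So its content determines P(z); [0 < mu R i] excludes empty rows in [Ytab]. *)
Lemma lattice_Ptab R i w : lattice R w -> 1 <= i <= size R -> 0 < mu R i ->
  Ptab [seq x <- w | inA R i x] = Ytab R i.
Proof.
move=> [_ h] hi hm; have [hc he] := h i hi; set z := filter _ _.
have hz : all (inA R i) z by exact: filter_all.
have eP : Ptab z = yam (off R i) (shape (Ptab z)).
  apply: yam_of_eps0; first exact: Ptab_cstrict.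
    by rewrite (perm_all _ (tword_perm z)); apply: sub_all hz => x /andP[].
  move=> r hr; have [-> _ _ _] := Ptab_crystal r z.
  case: (ltnP r (off R i + eta R i)) => hr2.
    by rewrite (eps_filter _ _ _).1 ?he //; rewrite /inA; lia.
  apply/eqP; rewrite -leqn0; apply: leq_trans (eps_count _ _) _.
  by rewrite leqn0; apply/eqP/count_memPn/negP => /(allP hz); rewrite /inA; lia.
have hn d : nth 0 (shape (Ptab z)) d = if d < eta R i then mu R i else 0.
  rewrite -(count_yam (off R i)) -eP (permP (tword_perm z)).
  case: ltnP => hd; last by apply/count_memPn/negP => /(allP hz); rewrite /inA; lia.
  by rewrite count_filter_in ?hc //; rewrite /inA; lia.
rewrite Ytab_yam eP; congr yam; have := shape_pos (Ptab_cstrict z).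
move: (shape (Ptab z)) hn => s hn hs.
have ss : size s = eta R i.
  case: (ltngtP (size s) (eta R i)) => // hlt.
    by have := hn (size s); rewrite nth_default // hlt; lia.
  by have := allP hs _ (mem_nth 0 hlt); rewrite hn ltnn.
apply: (@eq_from_nth _ 0); rewrite ss ?size_nseq // => d hd.
by rewrite nth_nseq hn hd.
Qed.

Lemma inW_lattice R w : (forall i, 1 <= i <= size R -> 0 < mu R i) ->
  inW R w <-> lattice R w.
Proof.
move=> hmu; split=> -[hall h]; split=> // i hi; have hm := hmu i hi.
  have {h} := h i hi; rewrite Ytab_yam => hk; split=> [x hx|r h1 h2].
    rewrite -(count_filter_in w hx) (permP (knuth_perm hk)).
    have [e he1 he2] : exists2 e, x = (off R i).+1 + e & e < eta R i.
      by exists (x - (off R i).+1); move: hx; rewrite /inA; lia.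
    by rewrite he1 count_yam nth_nseq he2.
  rewrite -(eps_filter w h1 h2).1; case: (knuth_crystal r hk) => -> _.
  by apply: eps_rect; move: h1; rewrite /inA; lia.
by rewrite -(@lattice_Ptab R i w) ?hm //; exact: knuth_Ptab.
Qed.

Definition lattice2 (a1 b1 a2 b2 : nat) (w : word) : Prop :=
  [/\ all (in1n (a1 + a2)) w,
      forall x, 0 < x <= a1 -> count_mem x w = b1,
      forall x, a1 < x <= a1 + a2 -> count_mem x w = b2,
      forall r, 0 < r < a1 -> eps r w = 0 &
      forall r, a1 < r < a1 + a2 -> eps r w = 0].

Lemma lattice2E a1 b1 a2 b2 w :
  lattice [:: (a1, b1); (a2, b2)] w <-> lattice2 a1 b1 a2 b2 w.
Proof.
rewrite /lattice /lattice2 /ntot /= addn0; split.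
  case=> h0 h; have [/= h1 h2] := h 1 isT; have [/= h3 h4] := h 2 isT.
  move: h1 h2 h3 h4; rewrite /inA /mu /eta /off /rect /= addn0 => h1 h2 h3 h4.
  split=> // [r hr|r hr]; first by apply: h2; lia.
  by apply: h4; lia.
case=> h0 h1 h2 h3 h4; split=> // i hi.
have {hi} [->|->] : i = 1 \/ i = 2 by lia.
  rewrite /inA /mu /eta /off /rect /=; split=> // r ? ?; apply: h3; lia.
by rewrite /inA /mu /eta /off /rect /= addn0; split=> // r ? ?; apply: h4; lia.
Qed.

Lemma lattice2_perm a1 b1 a2 b2 w : lattice2 a1 b1 a2 b2 w <->
  lattice2 a1 b1 a2 b2 (tword (Ptab w)).
Proof.
by split=> -[h0 h1 h2 h3 h4]; split=> [|x /h1|x /h2|r|r];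
  rewrite ?(perm_all _ (tword_perm w)) ?(permP (tword_perm w)) //
  in h0 *; move=> hr; case: (Ptab_crystal r w) (h3 r) (h4 r) => -> _ _ _; auto.
Qed.

(** Inside a block r and r+1 occur equally often, so [eps] and [phi] vanish together and their
    exchange by [star] does no harm. *)
Lemma lattice2_star a1 b1 a2 b2 w : lattice2 a1 b1 a2 b2 w ->
  lattice2 a2 b2 a1 b1 (star (a1 + a2) w).
Proof.
move=> [h0 h1 h2 h3 h4].
have hcs x : in1n (a1 + a2) x -> count_mem x (star (a1 + a2) w) = count_mem ((a1 + a2).+1 - x) w.
  exact: count_star.
have he r : 0 < r < a1 + a2 -> count_mem r w = count_mem r.+1 w -> eps r w = 0 ->
    eps (a1 + a2 - r) (star (a1 + a2) w) = 0.
  move=> hr hc her; have [-> _] := crystal_star h0 (r := r) (ltac:(lia)).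
  have := phi_eps_count r w; lia.
split.
- by rewrite addnC; apply: star_in1n.
- by move=> x hx; rewrite hcs ?h2 /in1n //; lia.
- by move=> x hx; rewrite hcs ?h1 /in1n //; lia.
- move=> r hr; have -> : r = a1 + a2 - (a1 + a2 - r) by lia.
  by apply: he; rewrite ?h2 ?h4 //; lia.
move=> r hr; have -> : r = a1 + a2 - (a1 + a2 - r) by lia.
by apply: he; rewrite ?h1 ?h3 //; lia.
Qed.

(** * Littlewood-Richardson tableaux for two rectangles *)

(** The lowest weight condition for the letters a+1, ..., n; it describes the rows below the first
    a1 rows of a tableau for two rectangles. *)
Definition lowest (a n : nat) (B : tableau) : Prop :=
  [/\ cstrict B, all (fun x => a < x <= n) (tword B) &
      forall r, a < r < n -> phi r (tword B) = 0].

Lemma lowest_cons a n row B : lowest a n (row :: B) -> lowest a n B.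
Proof.
case=> /= /and4P[_ _ _ hB]; rewrite tword_cons all_cat => /andP[hl _] hp.
by split=> // r /hp; rewrite phi_cat; lia.
Qed.

Lemma count_le_pred (x : nat) (s : seq nat) : 0 < x ->
  count (fun z => z <= x) s = count (fun z => z <= x.-1) s + count_mem x s.
Proof. by move=> hx; elim: s => //= z s ->; case: eqP; lia. Qed.

(* phi = 0 bounds the multiplicities of the top row from above, column
   strictness bounds them from below, and the bounds agree. *)
Lemma lowest_counts a n B : a <= n -> lowest a n B -> forall e, e <= n - a ->
  count (fun x => x <= n - e) (head [::] B) = nth 0 (shape B) e /\
  (e < n - a -> count_mem (n - e) (tword B) = nth 0 (shape B) e).
Proof.
move=> han; elim: B => [|row B IH] hB e he; first by rewrite nth_nil.
have IHB := IH (lowest_cons hB).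
case: hB => hcs; have /and4P[_ hs hd hcB] := hcs.
rewrite tword_cons all_cat => /andP[hlB hl] hp.
have dec j := cstrict_shape j hcs.
(* Here n - e = a + d, so the induction on d admits one more letter at a time, beginning with
   none. *)
have upper d : d <= n - a -> forall e, e = n - a - d ->
    count (fun x => x <= n - e) row <= nth 0 (shape (row :: B)) e.
  elim: d => [|d IHd] hdn f ef.
    suff -> : count (fun x => x <= n - f) row = 0 by [].
    apply/eqP; rewrite -leqn0 leqNgt -has_count; apply/hasPn => x /(allP hl); lia.
  case: f ef => [|f] ef.
    by rewrite subn0 /=; apply: count_size.
  have h1 := IHd (ltnW hdn) f.+2 ltac:(lia).
  rewrite count_le_pred; last by lia.
  have -> : (n - f.+1).-1 = n - f.+2 by lia.
  have [_ h2] := IHB f ltac:(lia); have [_ h3] := IHB f.+1 ltac:(lia).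
  have {}h2 := h2 ltac:(lia); have {}h3 := h3 ltac:(lia).
  (* For r = n-f-1, the absence of unmatched r in [tword B ++ row] bounds the number of r in [row]
     by the excess of r+1 over r in B, a difference of row lengths by [h2] and [h3]. *)
  have h4 := hp (n - f.+1) ltac:(lia).
  have h5 := phi_eps_count (n - f.+1) (tword B).
  have h6 : (n - f.+1).+1 = n - f by lia.
  rewrite h6 in h5.
  move: h4; rewrite phi_cat (phi_sorted _ hs).
  move: h1 (dec f.+1) => /=; lia.
have C f : f <= n - a ->
    count (fun x => x <= n - f) row = nth 0 (shape (row :: B)) f.
  move=> hf; apply/eqP; rewrite eqn_leq (upper (n - a - f)) /=; [|lia..].
  case: f hf => [|f] hf.
    rewrite subn0 /= leq_eqVlt eq_sym -all_count; apply/orP; left.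
    by apply: sub_all hl => x; lia.
  have [h1 _] := IHB f ltac:(lia); rewrite [nth _ _ _]/= -h1.
  by rewrite (_ : n - f = (n - f.+1).+1); [exact: dom_count_le|lia].
split; first exact: C.
move=> hlt; rewrite count_cat.
have [_ /(_ hlt) ->] := IHB e he.
have := C e he; rewrite count_le_pred; last lia.
have -> : (n - e).-1 = n - e.+1 by lia.
by rewrite (C e.+1 hlt) /=; lia.
Qed.

Lemma lowest_unique a n B1 B2 : a <= n -> lowest a n B1 -> lowest a n B2 ->
  shape B1 = shape B2 -> B1 = B2.
Proof.
move=> han; elim: B1 B2 => [|r1 B1 IH] [|r2 B2] // h1 h2 hs.
have [hs1 hs2] : size r1 = size r2 /\ shape B1 = shape B2 by case: hs.
rewrite (IH B2 (lowest_cons h1) (lowest_cons h2) hs2); congr (_ :: _).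
have C1 := lowest_counts han h1; have C2 := lowest_counts han h2.
case: h1 h2 => /= /and4P[_ s1 _ _] + _ [/= /and4P[_ s2 _ _] + _].
rewrite !tword_cons !all_cat => /andP[_ l1] /andP[_ l2].
apply: (sorted_eq leq_trans anti_leq) => //; apply/allP => x _; apply/eqP.
case: (boolP (a < x <= n)) => hx; last first.
  by rewrite !(count_memPn _) //; apply: contra hx; [move/(allP l2)|move/(allP l1)].
have [c1 _] := C1 (n - x) ltac:(lia); have [c2 _] := C2 (n - x) ltac:(lia).
have [c3 _] := C1 (n - x).+1 ltac:(lia); have [c4 _] := C2 (n - x).+1 ltac:(lia).
rewrite /= in c1 c2 c3 c4.
have e1 : n - (n - x) = x by lia.
have e2 : n - (n - x).+1 = x.-1 by lia.
rewrite e1 count_le_pred in c1; last lia.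
rewrite e1 count_le_pred in c2; last lia.
by rewrite e2 in c3 c4; move: c1 c2 c3 c4; rewrite hs1 hs2; lia.
Qed.

Lemma two_values (c g m : nat) row : c < g -> sorted leq row ->
  (forall x, x \in drop m row -> x = g) -> count_mem c row = m ->
  (forall x, x \in row -> c <= x) ->
  row = nseq m c ++ nseq (size row - m) g.
Proof.
move=> hcg hs hdrop hc hmin.
have hm : m <= size row by rewrite -hc count_size.
have cd : count_mem c (drop m row) = 0.
  by apply/count_memPn/negP => /hdrop; lia.
have ct : all (pred1 c) (take m row).
  rewrite all_count size_takel // -{2}hc -[in X in _ == X](cat_take_drop m row).
  by rewrite count_cat cd addn0.
rewrite -{1}(cat_take_drop m row); congr (_ ++ _).
  by rewrite [LHS](all_pred1P _ _ ct) size_takel.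
have cg : all (pred1 g) (drop m row) by apply/allP => x /hdrop ->; rewrite /= eqxx.
by rewrite [LHS](all_pred1P _ _ cg) size_drop.
Qed.

Lemma dom_drop m r s : dom r s -> dom (drop m r) (drop m s).
Proof.
elim: m r s => [|m IH] r s; first by rewrite !drop0.
by case: r s => [|a r] [|b s] //=; [rewrite dom_nil|move=> /andP[_ /IH]].
Qed.

(** The parameter k counts the rows already removed and m those still to be described. All b1 copies
    of k+1 lie in the top row, since lower rows only have larger letters; past column b1, column
    strictness bounds the entries from below and the matching condition from above, which leaves
    a1+k+1. *)
Lemma top_rows (a1 b1 n : nat) : 0 < b1 -> forall m k T, k + m = a1 ->
  cstrict T -> all (fun x => k < x <= n) (tword T) ->
  all (fun x => (x <= a1) || (a1 + k < x)) (drop b1 (head [::] T)) ->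
  (forall x, k < x <= a1 -> count_mem x (tword T) = b1) ->
  (forall r, k < r < a1 -> eps r (tword T) = 0) ->
  (forall r, a1 + k < r < n -> eps r (tword T) = 0) ->
  [/\ m <= size T,
    forall i, i < m -> b1 <= nth 0 (shape T) i /\
      nth [::] T i = nseq b1 (k + i).+1 ++
                     nseq (nth 0 (shape T) i - b1) (a1 + k + i).+1 &
    forall j, count_mem (a1 + j).+1 (tword T) =
      (if k <= j < a1 then nth 0 (shape T) (j - k) - b1 else 0)
      + count_mem (a1 + j).+1 (tword (drop m T))].
Proof.
move=> hb; elim=> [|m IH] k T hk.
  rewrite addn0 in hk; subst k => *; split=> // j.
  by rewrite drop0; case: ltnP; rewrite ?andbF // => h; rewrite leqNgt h.
case: T => [|row T] hcs hall hdrop hcnt he1 he2.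
  by have := hcnt k.+1 ltac:(lia); rewrite /=; lia.
have /and4P[_ hs hd hcT] := hcs.
move: hall; rewrite tword_cons all_cat => /andP[hallT hrow].
(* As [row] is sorted and ends the reading word, every x in it is unmatched for r = x-1, which the
   hypotheses allow only for these values. *)
have row_values x : x \in row -> x = k.+1 \/ a1 < x <= a1 + k.+1.
  move=> hx; have hx2 := allP hrow _ hx.
  have hcx : 0 < count_mem x row by rewrite -has_count has_pred1.
  have epsx : ~ (eps x.-1 (tword (row :: T)) = 0).
    rewrite tword_cons eps_cat (eps_sorted _ hs) prednK; lia.
  case: (ltnP x k.+2) => h1; first by left; lia.
  case: (leqP x a1) => h2; first by case: epsx; apply: he1; lia.
  case: (leqP x (a1 + k.+1)) => h3; first by right; lia.
  by case: epsx; apply: he2; lia.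
have hmin : all (leq k.+1) row by apply/allP => x /row_values; lia.
have hTk := cstrict_below hcs hmin.
have crow : count_mem k.+1 row = b1.
  have := hcnt k.+1 ltac:(lia); rewrite tword_cons count_cat.
  suff -> : count_mem k.+1 (tword T) = 0 by [].
  by apply/count_memPn/negP => /(allP hTk) /=; rewrite ltnn.
have hg x : x \in drop b1 row -> x = (a1 + k).+1.
  move=> hx; have := allP hdrop _ hx; case: (row_values x (mem_drop hx)) => [ex|]; last lia.
  move=> _; exfalso; move: crow; have hx' := hx.
  have hdc : 0 < count_mem k.+1 (drop b1 row) by rewrite -has_count has_pred1 -ex.
  have : count_mem k.+1 (take b1 row) = b1.
    have szb : b1 < size row by rewrite ltnNge; apply/negP => /drop_oversize e; rewrite e in hx.
    apply/eqP; rewrite -[X in _ == X](size_takel (ltnW szb)) -all_count; apply/allP => y hy /=.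
    have hy1 := allP hmin _ (mem_take hy); rewrite eqn_leq hy1 andbT -ex.
    move: hs; rewrite (sorted_pairwise leq_trans) -(cat_take_drop b1 row) pairwise_cat.
    by case/and3P => /allrelP h _ _; exact: h.
  move=> h; rewrite -(cat_take_drop b1 row) count_cat h; lia.
have erow : row = nseq b1 k.+1 ++ nseq (size row - b1) (a1 + k).+1.
  apply: two_values => //; first by lia.
  by move=> x /(allP hmin).
have hbs : b1 <= size row by rewrite -crow count_size.
have cr x : count_mem x row = (k.+1 == x) * b1 + ((a1 + k).+1 == x) * (size row - b1).
  by rewrite erow count_cat !count_nseq /= size_cat !size_nseq; lia.
have [h1 h2 h3] : [/\ m <= size T,
    forall i, i < m -> b1 <= nth 0 (shape T) i /\
      nth [::] T i = nseq b1 (k.+1 + i).+1 ++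
                     nseq (nth 0 (shape T) i - b1) (a1 + k.+1 + i).+1 &
    forall j, count_mem (a1 + j).+1 (tword T) =
      (if k.+1 <= j < a1 then nth 0 (shape T) (j - k.+1) - b1 else 0)
      + count_mem (a1 + j).+1 (tword (drop m T))].
  apply: (IH k.+1) => //; first by lia.
  - by apply/allP => x hx; have := allP hTk _ hx; have := allP hallT _ hx; lia.
  (* Past column b1 the row consists of a1+k+1, so the next row exceeds this letter there; this
     renews the assumption on [drop b1]. *)
  - have := dom_all_gt (dom_drop b1 hd) (c := (a1 + k).+1).
    rewrite (_ : all _ (drop b1 row)); last by apply/allP => x /hg ->.
    by move=> /(_ isT); apply: sub_all => x /=; lia.
  - move=> x hx; rewrite -(hcnt x); last lia.
    by rewrite tword_cons count_cat cr; lia.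
  - move=> r hr; have := he1 r ltac:(lia); rewrite tword_cons eps_cat (phi_sorted _ hs) cr; lia.
  - move=> r hr; have := he2 r ltac:(lia); rewrite tword_cons eps_cat (phi_sorted _ hs) cr; lia.
split=> //.
- case=> [|i] /= hi; first by rewrite !addn0.
  by have := h2 i hi; rewrite !addSn !addnS !addSn.
- move=> j; rewrite count_cat cr h3 [drop _ _]/=.
  have hka : k < a1 by rewrite -hk addnS ltnS leq_addr.
  have -> : (k.+1 == (a1 + j).+1) = false by clear -hka; lia.
  have -> : ((a1 + k).+1 == (a1 + j).+1) = (j == k) by rewrite eqSS eqn_add2l eq_sym.
  case: (ltngtP k j) => [hkj|hkj|ekj] /=; rewrite ?addn0 //.
    by rewrite -[in RHS](subnSK hkj).
  by rewrite -ekj hka subnn /= !mul1n !add0n addnC.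
Qed.

Lemma tword_cat A B : tword (A ++ B) = tword B ++ tword A.
Proof. by rewrite /tword rev_cat flatten_cat. Qed.

Lemma cstrict_drop_letters c k T : cstrict T -> all (leq c) (tword T) ->
  all (leq (c + k)) (tword (drop k T)).
Proof.
elim: k c T => [|k IH] c T hT hc; first by rewrite addn0 drop0.
case: T hT hc => [|row T] // hT; rewrite tword_cons all_cat => /andP[_ hr].
rewrite -addSnnS; apply: IH; last exact: cstrict_below hT hr.
by case/and4P: hT.
Qed.

Lemma nth_shape_le T i j : cstrict T -> i <= j -> nth 0 (shape T) j <= nth 0 (shape T) i.
Proof.
move=> hT /subnK <-; elim: (j - i) => // d IH.
by apply: leq_trans IH; rewrite addSn; apply: cstrict_shape.
Qed.

(* The shapes in the product of two rectangles, with rows counted from 0: rows j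
   and a1 + a2 - 1 - j are complementary, and the other rows are fixed. *)
Definition LR2_shape (a1 b1 a2 b2 : nat) (s : seq nat) : Prop :=
  [/\ forall j, j < a1 -> b1 <= nth 0 s j,
      forall j, a2 <= j < a1 -> nth 0 s j = b1,
      forall j, j < a2 ->
        (if j < a1 then nth 0 s j - b1 else 0) + nth 0 s (a1 + a2 - j.+1) = b2 &
      forall j, a1 + a2 <= j -> nth 0 s j = 0].

(** The first a1 rows are given by [top_rows], the others by [lowest_counts]. The b2 copies of a
    letter of the second block are split between an overhang of an upper row and the lower part,
    where their number is a row length; this makes rows complementary. *)
Lemma LR2_tableau a1 b1 a2 b2 T : 0 < b1 -> cstrict T ->
  lattice2 a1 b1 a2 b2 (tword T) ->
  [/\ a1 <= size T,
      forall i, i < a1 -> nth [::] T i =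
        nseq b1 i.+1 ++ nseq (nth 0 (shape T) i - b1) (a1 + i).+1,
      lowest a1 (a1 + a2) (drop a1 T) &
      LR2_shape a1 b1 a2 b2 (shape T)].
Proof.
move=> hb hT [hall h1 h2 h3 h4].
have hB : lowest a1 (a1 + a2) (drop a1 T).
  split; first exact: cstrict_drop.
    have hl : all (leq a1.+1) (tword (drop a1 T)).
      by rewrite -add1n; apply: cstrict_drop_letters => //; apply: sub_all hall => x /andP[].
    apply/allP => x hx; have -> : a1 < x by exact: (allP hl).
    have : x \in tword T by rewrite -(cat_take_drop a1 T) tword_cat mem_cat hx.
    by move/(allP hall) => /andP[].
  (* r and r+1 occur equally often, so [eps] = 0 gives [phi] = 0, and this passes to the prefix
     [tword (drop a1 T)] of the reading word. *)
  move=> r hr; have := phi_eps_count r (tword T).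
  rewrite h4 // h2; [rewrite h2|]; [|lia|lia].
  rewrite -{1}(cat_take_drop a1 T) tword_cat phi_cat; lia.
have [|||hsz htop hcnt] := @top_rows a1 b1 (a1 + a2) hb a1 0 T (add0n _) hT _ _ h1 h3 _.
- exact: hall.
- by apply/allP => x _; rewrite addn0; case: leqP.
- by move=> r; rewrite addn0; apply: h4.
have hn e : e <= a2 -> nth 0 (shape (drop a1 T)) e = nth 0 (shape T) (a1 + e).
  by move=> _; rewrite /shape map_drop nth_drop.
have hC := lowest_counts (leq_addr a2 a1) hB.
split=> //.
  by move=> i /htop [_ ->]; rewrite add0n addn0.
split.
- by move=> j /htop [].
- move=> j hj; have h0 : count_mem (a1 + j).+1 (tword T) = 0.
    by apply/count_memPn/negP => /(allP hall); rewrite /in1n; lia.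
  have [h _] := htop j ltac:(lia); have := hcnt j.
  by rewrite h0 subn0 leq0n; have /andP[_ ->] := hj; rewrite /=; lia.
- move=> j hj; have := hcnt j; rewrite (h2 (a1 + j).+1) ?subn0 ?leq0n; last lia.
  move=> ->; congr (_ + _).
  have [_ h] := hC (a2 - j.+1) ltac:(lia).
  have {}h := h ltac:(lia); rewrite hn in h; last lia.
  by rewrite -addnBA // -h (_ : a1 + a2 - (a2 - j.+1) = (a1 + j).+1) //; lia.
move=> j hj; apply/eqP; rewrite -leqn0.
apply: leq_trans (nth_shape_le hT hj) _.
(* At e = a2 the letters counted are at most a1, and the lower part has none. *)
have [+ _] := hC a2 ltac:(lia); rewrite hn // => <-.
rewrite leqNgt -has_count; apply/hasPn => x hx.
case: hB => _ hB _; suff : x \in tword (drop a1 T) by move/(allP hB); lia.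
by case: (drop a1 T) hx => //= r B hx; rewrite tword_cons mem_cat hx orbT.
Qed.

Lemma LR2_unique a1 b1 a2 b2 T1 T2 : 0 < b1 -> cstrict T1 -> cstrict T2 ->
  lattice2 a1 b1 a2 b2 (tword T1) -> lattice2 a1 b1 a2 b2 (tword T2) ->
  shape T1 = shape T2 -> T1 = T2.
Proof.
move=> hb c1 c2 l1 l2 hs.
have [s1 t1 b1' _] := LR2_tableau hb c1 l1; have [s2 t2 b2' _] := LR2_tableau hb c2 l2.
rewrite -(cat_take_drop a1 T1) -(cat_take_drop a1 T2); congr (_ ++ _).
  apply: (@eq_from_nth _ [::]); rewrite !size_takel // => i hi.
  by rewrite !nth_take // t1 // t2 // hs.
by apply: (lowest_unique (leq_addr a2 a1)) => //; rewrite /shape !map_drop -!/(shape _) hs.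
Qed.

(** Complementary rows obey the same equation in both shapes, so a cell withdrawn from row i must
    reappear in the row complementary to i. *)
Lemma LR2_shape_two a1 b1 a2 b2 s i j : LR2_shape a1 b1 a2 b2 (incr_nth s i) ->
  LR2_shape a1 b1 a2 b2 (incr_nth s j) -> i <> j -> i + j = (a1 + a2).-1.
Proof.
move=> [p1 q1 r1 z1] [p2 q2 r2 z2] /eqP nij.
have hi : i < a1 + a2.
  by rewrite ltnNge; apply/negP => /z1; rewrite nth_incr_nth eqxx.
have [nji eii] : (j == i) = false /\ (i == i) = true by rewrite eqxx eq_sym (negbTE nij).
case: (ltnP i a1) => h1.
  case: (ltnP i a2) => h2; last first.
    have := q1 i ltac:(lia); have := q2 i ltac:(lia).
    rewrite !nth_incr_nth eqxx nji; lia.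
  have := r1 i h2; have := r2 i h2; have := p2 i h1; rewrite !nth_incr_nth eqxx nji h1.
  by do ?[case: eqP => ?]; lia.
have h3 : (a1 + a2).-1 - i < a2 by lia.
have := r1 _ h3; have := r2 _ h3.
have -> : a1 + a2 - ((a1 + a2).-1 - i).+1 = i by lia.
rewrite !nth_incr_nth eqxx nji.
case: ltnP => h4; last by lia.
have := p1 _ h4; have := p2 _ h4; rewrite !nth_incr_nth.
by do ?[case: eqP => ?]; lia.
Qed.

(** * The action of simple reflections *)

(** Bookkeeping of the matching automaton: every r and r+1 of p ends up matched or on the stack, the
    first [phi r p] stack entries are consumed, and [new] holds the unmatched r+1. The hypothesis
    gives every r a partner. *)
Lemma match_aux_cat r p q i stk m : phi r p <= size stk ->
  exists m' new,
  [/\ match_aux r (p ++ q) i stk m =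
        match_aux r q (i + size p) (new ++ drop (phi r p) stk) m',
      size new = eps r p,
      forall j, [|| j \in m', j \in new | j \in drop (phi r p) stk] =
        [|| j \in m, j \in stk | (i <= j < i + size p) && (nth 0 p (j - i) \in [:: r; r.+1])] &
      forall j, j \in m' -> [|| j \in m, i <= j | j \in take (phi r p) stk]].
Proof.
elim: p i stk m => [|x p IH] i stk m /=.
  move=> _; exists m, [::]; rewrite addn0 drop0; split=> // j; last by move=> ->.
  rewrite (_ : (i <= j < i) = false) ?orbF //; lia.
have pos j : (i <= j < i + (size p).+1) && (nth 0 (x :: p) (j - i) \in [:: r; r.+1]) =
   (j == i) && (x \in [:: r; r.+1]) ||
   (i.+1 <= j < i.+1 + size p) && (nth 0 p (j - i.+1) \in [:: r; r.+1]).
  case: (ltngtP i j) => [h|h|->] /=; rewrite ?subnn ?ltnn ?andbF //.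
  - rewrite -[j - i]subnSK //= addSnnS; congr (_ && _).
  - by rewrite orbF addnS leq_addr.
case: (eqVneq x r.+1) => [ex|nx].
  subst x => hp; have [|m' [new [e1 e2 e3 e4]]] := IH i.+1 (i :: stk) m; first by move: hp => /=; lia.
  case: (posnP (phi r p)) => h0.
    exists m', (rcons new i); rewrite h0 size_rcons e2 addn1 /= drop0; split=> //.
    - by rewrite e1 h0 drop0 cat_rcons addSnnS.
    - move=> j; have := e3 j; rewrite h0 drop0 pos mem_rcons !inE eqxx orbT andbT.
      by rewrite -!orbA; case: (j == i); rewrite ?orbT.
    - by move=> j /e4; rewrite h0 take0 in_nil !orbF => /orP[->|h] //; rewrite (ltnW h) orbT.
  exists m', new; rewrite addn0; split=> //.
  - by rewrite e1 addSnnS -{1}(prednK h0).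
  - move=> j; have := e3 j; rewrite -{1}(prednK h0) /= => ->.
    by rewrite pos !inE eqxx orbT andbT -!orbA; do !bool_congr.
  - move=> j /e4; rewrite -{1}(prednK h0) /= inE.
    by case/or3P => [->|h|/orP[/eqP->|->]] //; rewrite ?leqnn ?(ltnW h) ?orbT.
case: (eqVneq x r) => [ex|nxr] hp.
  subst x; case: stk hp => // c stk hp.
  have [|m' [new [e1 e2 e3 e4]]] := IH i.+1 stk (i :: c :: m); first by [].
  exists m', new; split=> //.
  - by rewrite e1 addSnnS.
  - move=> j; have := e3 j => /= ->; rewrite pos !inE eqxx /= andbT.
    by rewrite -!orbA; do !bool_congr.
  - move=> j /e4; rewrite /= !inE => /or3P[/or3P[/eqP->|->|->]|h|->];
      rewrite ?leqnn ?(ltnW h) ?orbT //.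
have [|m' [new [e1 e2 e3 e4]]] := IH i.+1 stk m; first by [].
exists m', new; split=> //.
- by rewrite e1 addSnnS.
- by move=> j; rewrite e3 pos !inE (negbTE nx) (negbTE nxr) andbF.
- by move=> j /e4 /or3P[->|h|->] //; rewrite ?(ltnW h) ?orbT.
Qed.

Lemma match_aux_balanced r p q i stk m : phi r p = 0 -> eps r p = 0 ->
  exists m', [/\ match_aux r (p ++ q) i stk m = match_aux r q (i + size p) stk m',
     forall j, (j \in m') || (j \in stk) = [|| j \in m, j \in stk |
       (i <= j < i + size p) && (nth 0 p (j - i) \in [:: r; r.+1])] &
     forall j, j \in m' -> (j \in m) || (i <= j)].
Proof.
move=> hp he; have [|m' [new [e1 e2 e3 e4]]] := @match_aux_cat r p q i stk m.
  by rewrite hp.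
move: e1 e2 e3 e4; rewrite hp he drop0 take0 => e1 /size0nil enew e3 e4; subst new.
exists m'; split=> // j /e4.
by rewrite in_nil orbF.
Qed.

Lemma s_act_id r u : phi r u = 0 -> eps r u = 0 -> s_act r u = u.
Proof.
move=> hp he; have [m' [e1 e2 _]] := match_aux_balanced [::] 0 [::] [::] hp he.
rewrite cats0 /= in e1.
have eU : unmatched r u = [::].
  rewrite /unmatched /matched e1; apply/eqP; rewrite -size_eq0 size_filter -leqn0 leqNgt -has_count.
  apply/hasPn => j; rewrite mem_iota add0n => /andP[_ hj].
  have := e2 j; rewrite !in_nil !orbF /= add0n subn0 hj /= => ->.
  by rewrite andbN.
rewrite /s_act eU /=; apply: (@eq_from_nth _ 0); rewrite size_map size_iota // => j hj.
by rewrite (nth_map 0) ?size_iota // nth_iota.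
Qed.

(** The word splits as p, r+1, q with p and q completely matched, so the middle letter is the only
    unmatched one and both maps turn it into r. *)
Lemma s_act_raise r u : phi r u = 0 -> eps r u = 1 -> s_act r u = raise r u.
Proof.
move=> hp he; have [|p [q [eu ep pq ->]]] := @raiseP r u; first by rewrite he.
have [pp eq] : phi r p = 0 /\ eps r q = 0.
  by move: hp he; rewrite eu phi_cat eps_cat /= eqxx ep pq eqxx; lia.
have [m1 [e1 f1 g1]] := match_aux_balanced (r.+1 :: q) 0 [::] [::] pp ep.
have [m2 [e2 f2 g2]] := match_aux_balanced [::] (size p).+1 [:: size p] m1 pq eq.
have em : matched r u = m2.
  by rewrite /matched eu e1 /= eqxx -[q]cats0 e2.
have eU : unmatched r u = [:: size p].
  rewrite /unmatched em eu size_cat iotaD filter_cat /= nth_cat ltnn subnn /= !inE eqxx orbT.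
  have -> : size p \notin m2.
    apply/negP => /g2; rewrite ltnn orbF => h; have := f1 (size p).
    by rewrite h !in_nil /= ltnn.
  have nm j : [|| (j < size p) && (nth 0 p j \in [:: r; r.+1]) |
       (size p < j < (size p).+1 + size q) && (nth 0 q (j - (size p).+1) \in [:: r; r.+1])] ->
       j != size p -> j \in m2.
    move=> h hj; have := f2 j; rewrite mem_seq1 (negbTE hj) orbF => ->.
    have := f1 j; rewrite !in_nil !orbF /= add0n subn0 => ->.
    exact: h.
  rewrite (eq_in_filter (a2 := pred0)) => [|j]; last first.
    rewrite mem_iota add0n => /andP[_ hj]; rewrite nth_cat hj /=.
    case hr: (_ \in _) => //=; rewrite nm //; last by rewrite (ltn_eqF hj).
    by rewrite hj hr.
  rewrite filter_pred0 (eq_in_filter (a2 := pred0)) => [|j]; last first.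
    rewrite mem_iota add0n => /andP[hj1 hj2]; rewrite nth_cat ltnNge (ltnW hj1) /=.
    rewrite -[j - size p]subnSK //=.
    case hr: (_ \in _) => //=; rewrite nm //; last by rewrite (gtn_eqF hj1).
    by rewrite hj1 hj2 hr orbT.
  by rewrite filter_pred0.
rewrite /s_act eU /= eu nth_cat ltnn subnn /= eqxx addn0.
apply: (@eq_from_nth _ 0); rewrite size_map size_iota !size_cat //= => j hj.
rewrite (nth_map 0) ?size_iota // nth_iota // add0n mem_seq1 !nth_cat.
case: (ltngtP j (size p)) => [h|h|h] //=; last by rewrite h subnn.
by rewrite -[j - size p]subnSK.
Qed.

Lemma act_cat g1 g2 u : act (g1 ++ g2) u = act g1 (act g2 u).
Proof. exact: foldr_cat. Qed.

Lemma act_id gs u : (forall r, r \in gs -> phi r u = 0 /\ eps r u = 0) -> act gs u = u.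
Proof.
elim: gs => //= r gs IH h; rewrite IH => [|c hc]; last by apply: h; rewrite inE hc orbT.
by have [hp he] := h r (mem_head _ _); apply: s_act_id.
Qed.

(** * The cyclage map on Littlewood-Richardson words *)

Lemma off_succ R i : 0 < i -> off R i.+1 = off R i + eta R i.
Proof.
case: i => // i _; rewrite /off /eta /rect /=.
elim: R i => [|r R IH] [|i] //=; first by rewrite take0 /= addn0.
by rewrite IH addnA.
Qed.

Lemma off_le R i j : 0 < i -> i <= j -> off R i <= off R j.
Proof.
move=> hi /subnK <-; elim: (j - i) => // d IH.
by rewrite addSn off_succ ?(leq_trans IH) ?leq_addr //; lia.
Qed.

Lemma off_ntot R i : i <= size R -> off R i.+1 <= ntot R.
Proof.
move=> hi; rewrite /off /ntot /= -[X in _ <= sumn X](cat_take_drop i (map fst R)).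
by rewrite sumn_cat leq_addr.
Qed.

Lemma inA_off R i x : 0 < i -> inA R i x = (off R i < x <= off R i.+1).
Proof. by move=> hi; rewrite /inA off_succ. Qed.

Lemma inA_inj R i j x : 0 < i -> 0 < j -> inA R i x -> inA R j x -> i = j.
Proof.
move=> hi hj; rewrite !inA_off // => h1 h2.
case: (ltngtP i j) => // h.
- have := off_le R (ltn0Sn i) h; lia.
- have := off_le R (ltn0Sn j) h; lia.
Qed.

Lemma ex_inA R x : 0 < x <= ntot R -> exists2 i, 1 <= i <= size R & inA R i x.
Proof.
move=> hx; have : x <= off R (size R).+1.
  by rewrite /off /= take_oversize ?size_map //; move/andP: hx => [].
suff H m : m <= size R -> x <= off R m.+1 -> exists2 i, 1 <= i <= size R & inA R i x.
  exact: H.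
elim: m => [|m IH] hm hxm.
  by move: hxm; rewrite /off /= take0 /=; lia.
case: (leqP x (off R m.+1)) => h; first by apply: IH => //; apply: ltnW.
by exists m.+1; rewrite ?inA_off //= ?h.
Qed.

Definition interior (R : seq (nat * nat)) (i r : nat) : bool :=
  (off R i < r) && (r < off R i + eta R i).

Lemma interior_inA R i r : interior R i r = inA R i r && inA R i r.+1.
Proof. by rewrite /interior /inA; lia. Qed.

Definition raises (gs : seq nat) (u : word) : word :=
  foldl (fun v r => raise r v) u gs.

Definition block_gens (a h : nat) : seq nat := [seq a + k | k <- iota 1 h.-1].

Lemma cells_raises gs u : cells (raises gs u) = cells u.
Proof.
elim: gs u => //= r gs IH u; rewrite /raises /= -/(raises _ _) IH.
by case: (Ptab_crystal r u).
Qed.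

Lemma w0_block_mem a h r : r \in w0_block a h -> a < r < a + h.
Proof.
move=> /flatten_mapP [j]; rewrite mem_iota => hj /mapP [k]; rewrite mem_rev mem_iota; lia.
Qed.

Lemma w0_blockS a h : w0_block a h.+2 = w0_block a h.+1 ++ [seq a + k | k <- rev (iota 1 h.+1)].
Proof.
rewrite /w0_block [h.+2.-1]/= [h.+1.-1]/=.
have {1}-> : iota 1 h.+1 = iota 1 h ++ [:: h.+1] by rewrite -[h.+1]addn1 iotaD addnC.
by rewrite map_cat flatten_cat /= cats0.
Qed.

(** The rightmost factor of [w0_block] acts first and runs through all generators in ascending
    order, giving v'. The remaining factors of the block avoid its last generator and fix v'; those
    of other blocks fix v and v'. *)
Lemma act_w0R R i v v' : 1 <= i <= size R ->
  (forall j r, 1 <= j <= size R -> j != i -> interior R j r ->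
     [/\ phi r v = 0, eps r v = 0, phi r v' = 0 & eps r v' = 0]) ->
  (forall r, off R i < r -> r.+1 < off R i + eta R i -> phi r v' = 0 /\ eps r v' = 0) ->
  foldl (fun u r => s_act r u) v (block_gens (off R i) (eta R i)) = v' ->
  act (w0R R) v = v'.
Proof.
move=> hi hother hlast hv.
have ei : iota 1 (size R) = iota 1 i.-1 ++ i :: iota i.+1 (size R - i).
  have -> : size R = i.-1 + (size R - i).+1 by lia.
  rewrite iotaD /=; congr (_ ++ _ :: iota _ _); lia.
rewrite /w0R ei map_cat flatten_cat /= !act_cat.
rewrite [X in act _ (act _ X)]act_id; last first.
  move=> r /flatten_mapP [j]; rewrite mem_iota => hj /w0_block_mem hr.
  by have [] := hother j r ltac:(lia) ltac:(lia) hr.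
have -> : act (w0_block (off R i) (eta R i)) v = v'.
  move: hv hlast; rewrite /block_gens; case: (eta R i) => [|[|h]] hv hlast; [exact: hv|exact: hv|].
  rewrite w0_blockS act_cat; have -> : act [seq off R i + k | k <- rev (iota 1 h.+1)] v = v'.
    by rewrite -hv /act map_rev -[in RHS](revK (map _ _)) foldl_rev.
  apply: act_id => r /w0_block_mem hr; apply: hlast; lia.
apply: act_id => r /flatten_mapP [j]; rewrite mem_iota => hj /w0_block_mem hr.
by have [] := hother j r ltac:(lia) ltac:(lia) hr.
Qed.

Lemma s_act_letter r : s_act r [:: r] = [:: r.+1].
Proof.
by rewrite /s_act /unmatched /matched /= (ltn_eqF (ltnSn r)) eqxx inE eqxx /= (ltn_eqF (ltnSn r)).
Qed.

Lemma act_w0R_letter R i : 1 <= i <= size R -> 0 < eta R i ->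
  act (w0R R) [:: (off R i).+1] = [:: off R i + eta R i].
Proof.
move=> hi he.
have single r x : x != r -> x != r.+1 -> phi r [:: x] = 0 /\ eps r [:: x] = 0.
  by move=> h1 h2; rewrite /= (negbTE h1) (negbTE h2).
apply: act_w0R (hi) _ _ _.
- move=> j r hj hji hr; have hr' := hr; rewrite interior_inA in hr'.
  have dis x : inA R i x -> x != r /\ x != r.+1.
    move=> hx; split; apply: contraNneq hji => ex; subst x; apply/eqP.
      by apply: (@inA_inj R j i r); [lia|lia|case/andP: hr'|].
    by apply: (@inA_inj R j i r.+1); [lia|lia|case/andP: hr'|].
  have [h1 h2] := dis (off R i).+1 ltac:(rewrite /inA; lia).
  have [h3 h4] := dis (off R i + eta R i) ltac:(rewrite /inA; lia).
  by have [-> ->] := single _ _ h1 h2; have [-> ->] := single _ _ h3 h4.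
- by move=> r h1 h2; apply: single; lia.
move: he; rewrite /block_gens; case: (eta R i) => // h _.
elim: h => [|h IH]; first by rewrite /= addn1.
rewrite -[h.+2.-1]addn1 iotaD map_cat foldl_cat IH /= add1n.
by rewrite s_act_letter !addnS.
Qed.

Lemma count_le_ins_row x y row :
  count (fun z => z <= y) row + (x == y) <= count (fun z => z <= y) (ins_row x row).2.
Proof.
elim: row => [|z row IH] /=; first by rewrite addn0; case: eqP => // ->; rewrite leqnn.
case: ltnP => hx /=; first by case: eqP; lia.
by case: (ins_row x row) IH => b r /=; lia.
Qed.

(** Inserting y adds an entry at most y to the first row, and no insertion lowers the number of such
    entries. *)
Lemma count_le_row1 w y : count_mem y w <= nth 0 (shape (Ptab w)) 0.
Proof.
suff h : count_mem y w <= count (fun z => z <= y) (head [::] (Ptab w)).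
  by apply: leq_trans h _; case: (Ptab w) => //= r T; apply: count_size.
elim/last_ind: w => // w x IH; rewrite Ptab_rcons head_ins.
apply: leq_trans (count_le_ins_row x y _); rewrite -cats1 count_cat /= addn0.
by rewrite leq_add2r.
Qed.

(** Invariant under raising within the block, since shapes are, and a bound for the multiplicity of
    each of its letters. It limits how often a letter can be raised. *)
Definition row1_bounded (a h b : nat) (v : word) : bool :=
  nth 0 (shape (Ptab [seq x <- v | a < x <= a + h])) 0 <= b.

Lemma row1_bounded_raise a h b r v : a < r < a + h ->
  row1_bounded a h b (raise r v) = row1_bounded a h b v.
Proof.
by move=> hr; rewrite /row1_bounded raise_filter ?shape_raise //; lia.
Qed.

Lemma row1_bounded_count a h b y v : a < y <= a + h -> row1_bounded a h b v ->
  count_mem y v <= b.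
Proof.
move=> hy; apply: leq_trans; rewrite -(@count_filter_in (fun x => a < x <= a + h)) //.
exact: count_le_row1.
Qed.

Lemma row1_bounded_eps a h b r v : a < r < a + h -> row1_bounded a h b v ->
  count_mem r v = b -> eps r v = 0.
Proof.
move=> hr hb hc; case: (posnP (eps r v)) => // he.
have := count_raise r he; rewrite eqxx (ltn_eqF (ltnSn r)) addn0 hc => hcr.
have := @row1_bounded_count a h b r (raise r v); rewrite row1_bounded_raise // hb.
by rewrite hcr; lia.
Qed.

(* With row1_bounded, the counts force a single unmatched r+1 at each step. *)
Lemma raises_block a h b u : row1_bounded a h b u ->
  (forall y, a < y <= a + h -> count_mem y u + (y == a.+1) = b) ->
  forall m, m < h -> let gs := [seq a + k | k <- iota 1 m] in
  [/\ row1_bounded a h b (raises gs u),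
      foldl (fun v r => s_act r v) u gs = raises gs u &
      forall y, a < y <= a + h -> count_mem y (raises gs u) + (y == a + m.+1) = b].
Proof.
(* The letter that occurs only b-1 times is a+1 at the start and moves up by one with each
   raising. *)
move=> hb hc; elim=> [|m IH] hm gs.
  by split=> // y /hc; rewrite addn1.
have [h1 h2 h3] := IH (ltnW hm).
have -> : gs = [seq a + k | k <- iota 1 m] ++ [:: a + m.+1].
  by rewrite /gs -(addn1 m) (iotaD 1 m 1) map_cat add1n addn1.
rewrite /raises !foldl_cat -/(raises _ u) h2 /= {gs}.
set v := raises _ u in h1 h2 h3 *; set r := a + m.+1 in h3 *.
have hr : a < r < a + h by rewrite /r; lia.
have c1 := h3 r ltac:(lia); have c2 := h3 r.+1 ltac:(lia).
rewrite eqxx in c1; rewrite (gtn_eqF (ltnSn r)) addn0 in c2.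
have hpe := phi_eps_count r v.
have he : 0 < eps r v by lia.
have hcr := count_raise r he; rewrite eqxx (ltn_eqF (ltnSn r)) addn0 in hcr.
(* After one raising r occurs b times, and another would exceed the bound on the first row. *)
have he1 : eps r v = 1.
  have := @row1_bounded_eps a h b r (raise r v) hr.
  rewrite row1_bounded_raise // h1 => /(_ isT).
  by have := eps_raise he; lia.
split.
- by rewrite row1_bounded_raise.
- by apply: s_act_raise => //; lia.
move=> y hy; have := h3 y hy; have := count_raise y he; rewrite (_ : r.+1 = a + m.+2); [|by rewrite /r; lia].
by move=> -> ->.
Qed.

Lemma filter_raises (B : pred nat) gs u : (forall r, r \in gs -> ~~ B r /\ ~~ B r.+1) ->
  filter B (raises gs u) = filter B u.
Proof.
elim: gs u => //= r gs IH u h; rewrite /raises /= -/(raises _ _) IH.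
  by have [h1 h2] := h r (mem_head _ _); rewrite raise_filterN.
by move=> c hc; apply: h; rewrite inE hc orbT.
Qed.

Lemma raises_letters (B : pred nat) gs u : all B gs -> all B u -> all B (raises gs u).
Proof.
elim: gs u => //= r gs IH u /andP[hr hgs] hu; apply: IH => //.
exact: raise_letters.
Qed.

Lemma block_gensP a h r : r \in block_gens a h -> a < r < a + h.
Proof. by move=> /mapP [k]; rewrite mem_iota; lia. Qed.

Definition positive (R : seq (nat * nat)) : Prop :=
  forall i, 1 <= i <= size R -> 0 < eta R i /\ 0 < mu R i.

(** A last letter r+1 is always unmatched, so x-1 cannot belong to the block of x. *)
Lemma lattice_last R u x i : 1 <= i <= size R -> lattice R (rcons u x) ->
  inA R i x -> x = (off R i).+1.
Proof.
move=> hi [_ h] hx; have [_ he] := h i hi.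
case: (ltnP (off R i).+1 x) => hlt; last by move: hx; rewrite /inA; lia.
have := he x.-1; rewrite eps_rcons prednK ?eqxx; last by lia.
by rewrite hx /inA => /(_ _ isT); move: hx; rewrite /inA; lia.
Qed.

(** Deleting the last letter a+1 leaves a gap in the content of its block; the raisings move the gap
    up to a+h, where the new first letter fills it. *)
Lemma chi_lattice R u x i : positive R -> 1 <= i <= size R -> inA R i x ->
  lattice R (rcons u x) ->
  let y := off R i + eta R i in
  let v := raises (block_gens (off R i) (eta R i)) u in
  chi R (rcons u x) = y :: v /\ lattice R (y :: v).
Proof.
move=> hpos hi hx hlat y v; have ex := lattice_last hi hlat hx.
have [heta hmu] := hpos i hi.
set a := off R i in y v ex *; set h := eta R i in heta y v *; set b := mu R i in hmu.
have [hall hblk] := hlat; have [hcnt heps] := hblk i hi.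
(* Removing the last letter cannot lengthen the first row, which for the whole block subword is that
   of a rectangle with b columns. *)
have hbnd : row1_bounded a h b u.
  apply: (@leq_trans (nth 0 (shape (Ptab [seq z <- rcons u x | inA R i z])) 0)).
    rewrite filter_rcons hx shape_Ptab_rcons nth_incr_nth.
    by rewrite leq_addl.
  by rewrite (lattice_Ptab hlat hi hmu) Ytab_yam -/h -/b; case: (h) => //= k; rewrite size_nseq.
have hcu c : a < c <= a + h -> count_mem c u + (c == a.+1) = b.
  by move=> /hcnt; rewrite -/b => <-; rewrite -cats1 count_cat ex /= addn0 [_ == c]eq_sym.
have [hbv hsv hcv] := raises_block hbnd hcu (m := h.-1) ltac:(lia).
rewrite -/(block_gens a h) -/v in hbv hsv hcv.
rewrite (_ : a + h.-1.+1 = y) in hcv; last by rewrite /y prednK.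
have hev r : a < r -> r.+1 <= a + h -> eps r v = 0.
  move=> h1 h2; apply: (@row1_bounded_eps a h b) => //; first by lia.
  by have := hcv r ltac:(lia); rewrite /y; lia.
have hother j c : 1 <= j <= size R -> j != i -> inA R j c -> ~~ inA R i c.
  by move=> hj hji hjc; apply: contra hji => hic; apply/eqP/(@inA_inj R j i c); lia.
have hfilt j : 1 <= j <= size R -> j != i ->
    [seq z <- v | inA R j z] = [seq z <- u | inA R j z].
  move=> hj hji; apply: filter_raises => r /block_gensP hr.
  by split; apply/negP => /(hother _ _ hj hji)/negP; apply; rewrite /inA -/a -/h; lia.
have hoeps j r : 1 <= j <= size R -> j != i -> interior R j r ->
    [/\ phi r u = 0, eps r u = 0, phi r v = 0 & eps r v = 0].
  move=> hj hji; rewrite interior_inA => /andP[r1 r2].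
  have [hcj hej] := hblk j hj.
  have n1 : x != r by apply: contraNneq (hother _ _ hj hji r1) => <-.
  have n2 : x != r.+1 by apply: contraNneq (hother _ _ hj hji r2) => <-.
  have := hej r r1 r2; rewrite eps_rcons (negbTE n1) (negbTE n2) add0n subn0 => e0.
  have := phi_eps_count r (rcons u x); rewrite !hcj // eps_rcons phi_rcons (negbTE n1) (negbTE n2).
  rewrite e0 => hph.
  have -> : phi r v = phi r u.
    by rewrite -(eps_filter v r1 r2).2 hfilt // (eps_filter u r1 r2).2.
  have -> : eps r v = eps r u.
    by rewrite -(eps_filter v r1 r2).1 hfilt // (eps_filter u r1 r2).1.
  by rewrite e0; split=> //; lia.
have hact : act (w0R R) u = v.
  apply: (@act_w0R R i) => // r r1 r2; rewrite -/a -/h in r1 r2.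
  have e0 := hev r r1 ltac:(lia); rewrite e0; split=> //.
  have := phi_eps_count r v; have := hcv r ltac:(lia); have := hcv r.+1 ltac:(lia).
  by rewrite e0 /y; lia.
split.
  rewrite /chi; case E: (rcons u x) => [|c s]; first by case: (u) E.
  rewrite -E last_rcons size_rcons /= -cats1 take_size_cat // hact ex.
  by rewrite act_w0R_letter.
have hyR : in1n (ntot R) y.
  have := off_ntot (R := R) (i := i) ltac:(lia); rewrite off_succ ?/in1n /y -/a -/h; lia.
split.
  rewrite /= hyR /=; apply: raises_letters.
    by apply/allP => r /block_gensP; move: hyR; rewrite /in1n /y; lia.
  by move: hall; rewrite all_rcons => /andP[].
move=> j hj; case: (eqVneq j i) => [->|hji].
  split=> [c hc|r r1 r2]; first by have := hcv c hc; rewrite /= -/b [y == c]eq_sym; lia.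
  have hr : a < r < a + h by move: r1 r2; rewrite /inA -/a -/h; lia.
  have e0 := hev r ltac:(lia) ltac:(lia); rewrite /= e0.
  (* Here r+1 = a+h: v has b letters r and b-1 letters r+1, so an r is left to match the y in
     front. *)
  case: eqP => // ey; have := phi_eps_count r v; have := hcv r ltac:(lia); have := hcv r.+1 ltac:(lia).
  by rewrite e0 ey eqxx; lia.
have [hcj hej] := hblk j hj.
have hyn : ~~ inA R j y.
  by apply/negP => /(hother _ _ hj hji)/negP; apply; rewrite /inA -/a -/h /y; lia.
split=> [c hc|r r1 r2].
  rewrite /= (_ : (y == c) = false); last by apply: contraNF hyn => /eqP ->.
  rewrite add0n -(count_filter_in v hc) hfilt // count_filter_in // -(hcj c hc).
  rewrite -cats1 count_cat /= addn0 (_ : (x == c) = false) ?addn0 //.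
  by apply: contraNF (hother _ _ hj hji hc) => /eqP <-.
rewrite /= (_ : (y == r.+1) = false); last by apply: contraNF hyn => /eqP ->.
by have [] := hoeps j r hj hji ltac:(by rewrite interior_inA r1 r2).
Qed.

(** * Two rectangles *)

(** [star] keeps the shape and exchanges the rectangles, so the shape obeys the conditions in both
    orders; in particular it contains each rectangle placed at the origin. *)
Lemma LR2_of_word a1 b1 a2 b2 w : 0 < b1 -> 0 < b2 -> lattice2 a1 b1 a2 b2 w ->
  LR2_shape a1 b1 a2 b2 (shape (Ptab w)) /\ LR2_shape a2 b2 a1 b1 (shape (Ptab w)).
Proof.
move=> hb1 hb2 hw; split.
  by have [] := LR2_tableau hb1 (Ptab_cstrict w) ((lattice2_perm _ _ _ _ _).1 hw).
have [hin _ _ _ _] := hw; rewrite -(shape_star hin).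
have hs := lattice2_star hw.
by have [] := LR2_tableau hb2 (Ptab_cstrict _) ((lattice2_perm _ _ _ _ _).1 hs).
Qed.

Lemma inW2 a1 b1 a2 b2 w : 0 < b1 -> 0 < b2 ->
  inW [:: (a1, b1); (a2, b2)] w <-> lattice2 a1 b1 a2 b2 w.
Proof.
move=> hb1 hb2; rewrite -lattice2E; apply: inW_lattice => i hi.
by have [->|->] : i = 1 \/ i = 2 by move: hi => /=; lia.
Qed.

(** Both choices are inhabited: the tableau by P of [star (a1 + a2) w], which [LR2_unique]
    identifies with the chosen one, and the word by [RS_surj]. *)
Lemma tau1_wordP a1 b1 a2 b2 w : 0 < b1 -> 0 < b2 -> lattice2 a1 b1 a2 b2 w ->
  let u := tau1_word (a1, b1) (a2, b2) w in
  lattice2 a2 b2 a1 b1 u /\ cells u = cells w.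
Proof.
move=> hb1 hb2 hw; have [hin _ _ _ _] := hw; have hs := lattice2_star hw.
set t := star (a1 + a2) w in hs; have sht : shape (Ptab t) = shape (Ptab w) by exact: shape_star.
pose T := tau1_tab (a1, b1) (a2, b2) (Ptab w).
have [sT [cT lT]] : LRT (shape (Ptab w)) [:: (a2, b2); (a1, b1)] T.
  apply: epsilon_spec; exists (Ptab t); split; first by [].
  rewrite column_strictE Ptab_cstrict; split=> //.
  exact/(inW2 _ _ _ hb2 hb1)/(lattice2_perm _ _ _ _ _).1.
rewrite column_strictE in cT; have {}lT := (inW2 _ _ _ hb2 hb1).1 lT.
have eT : T = Ptab t.
  apply: (LR2_unique hb2 cT (Ptab_cstrict t) lT); last by rewrite sT.
  exact/(lattice2_perm _ _ _ _ _).1.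
have hex : exists u, Ptab u = T /\ Qtab u = Qtab w.
  have [|||u hP hc] := @RS_surj w t; first exact: in1n_gt0 hin.
  - by case: hs => /in1n_gt0.
  - by rewrite sht.
  by exists u; rewrite eT; split=> //; apply/Qtab_cells.
have : Ptab (tau1_word (a1, b1) (a2, b2) w) = T /\
       Qtab (tau1_word (a1, b1) (a2, b2) w) = Qtab w.
  exact: (epsilon_spec (inhabits [::]) _ hex).
case=> hP hQ; split; last by apply/Qtab_cells.
by apply/(lattice2_perm _ _ _ _ _).2; rewrite hP.
Qed.

Lemma tau1_word_unique a1 b1 a2 b2 w u : 0 < b1 -> 0 < b2 ->
  lattice2 a1 b1 a2 b2 w -> lattice2 a2 b2 a1 b1 u -> cells u = cells w ->
  u = tau1_word (a1, b1) (a2, b2) w.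
Proof.
move=> hb1 hb2 hw hu hc; have [hu' hc'] := tau1_wordP hb1 hb2 hw.
apply: RS_inj; last by rewrite hc hc'.
apply: (@LR2_unique a2 b2 a1 b1) => //; try exact: Ptab_cstrict.
- exact/(lattice2_perm _ _ _ _ _).1.
- exact/(lattice2_perm _ _ _ _ _).1.
by rewrite !shape_cells hc hc'.
Qed.

Lemma incr_nth_inj s : injective (incr_nth s).
Proof.
move=> i j h; have := nth_incr_nth s i i; rewrite h nth_incr_nth eqxx.
by case: eqP => //; lia.
Qed.

Lemma new_cell_row n u x i : all (in1n n) (rcons u x) ->
  shape (Ptab (rcons u x)) = incr_nth (shape (Ptab u)) i -> x + i <= n.
Proof.
rewrite all_rcons shape_Ptab_rcons => /andP[hx hu] /incr_nth_inj <-.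
apply: ins_row_index; last by case/andP: hx.
by rewrite (perm_all _ (tword_perm u)); apply: sub_all hu => c /andP[].
Qed.

Lemma new_cell_col n u i : all (in1n n) u ->
  shape (Ptab (rcons u 1)) = incr_nth (shape (Ptab u)) i ->
  nth 0 (shape (Ptab u)) i < count_mem 1 (rcons u 1).
Proof.
rewrite shape_Ptab_rcons => hu /incr_nth_inj <-.
rewrite -cats1 count_cat addn1 ltnS; apply: leq_trans (ins_col_index 1 (Ptab_cstrict u)) _.
rewrite -(permP (tword_perm u)); have : all (ltn 0) (tword (Ptab u)).
  by rewrite (perm_all _ (tword_perm u)); apply: in1n_gt0 hu.
case: (Ptab u) => [|r T] //; rewrite tword_cons all_cat count_cat => /andP[_ hr] /=.
apply: leq_trans (leq_addl _ _); rewrite (@eq_in_count _ _ (pred1 1)) // => c /(allP hr) /=; lia.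
Qed.

(** The letter x that [chi] removes from the end and the letter y that it puts in front are the
    smallest and the largest letter of one block. *)
Definition corner_letters (a1 a2 x y : nat) : Prop :=
  (x = 1 /\ y = a1) \/ (x = a1.+1 /\ y = a1 + a2).

(** Each end of the cyclage gives one bound on the cell. For the first block, the last letter 1
    bounds the column by b1 and the complement a2+1 of y bounds the row by a1; for the second block
    the complement of y is 1, and the roles are exchanged. *)
Lemma same_cell_in_rectangles a1 b1 a2 b2 u x y v i : 0 < a1 ->
  lattice2 a1 b1 a2 b2 (rcons u x) -> lattice2 a1 b1 a2 b2 (y :: v) ->
  cells v = cells u -> corner_letters a1 a2 x y ->
  shape (Ptab (rcons u x)) = incr_nth (shape (Ptab u)) i ->
  shape (Ptab (y :: v)) = incr_nth (shape (Ptab u)) i ->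
  (i < a1 /\ nth 0 (shape (Ptab u)) i < b1) \/
  (i < a2 /\ nth 0 (shape (Ptab u)) i < b2).
Proof.
move=> ha1 hw hv hc hxy s1 s2.
have [win w1 w2 _ _] := hw; have [vin v1 v2 _ _] := hv.
have vin' : all (in1n (a1 + a2)) v by case/andP: vin.
have uin : all (in1n (a1 + a2)) u by move: win; rewrite all_rcons => /andP[].
have emu : shape (Ptab (star (a1 + a2) v)) = shape (Ptab u).
  by rewrite shape_star // !shape_cells hc.
have s3 : shape (Ptab (rcons (star (a1 + a2) v) ((a1 + a2).+1 - y)))
    = incr_nth (shape (Ptab (star (a1 + a2) v))) i.
  by rewrite -star_cons shape_star // s2 emu.
have sin := star_in1n vin; rewrite star_cons in sin.
have r1 := new_cell_row win s1; have r2 := new_cell_row sin s3.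
case: hxy => -[ex ey]; subst x y; [left|right].
  split; first by lia.
  by have := new_cell_col uin s1; rewrite w1 //; lia.
split; first by lia.
have e1 : (a1 + a2).+1 - (a1 + a2) = 1 by lia.
rewrite e1 in s3; have := new_cell_col (star_in1n vin') s3.
rewrite emu -e1 -star_cons count_star //; last by rewrite /in1n; lia.
rewrite e1 subn1 /= -[_ + _]/(count_mem (a1 + a2) (a1 + a2 :: v)) v2 //.
lia.
Qed.

Lemma shape_cons n y v : all (in1n n) (y :: v) ->
  exists j, shape (Ptab (y :: v)) = incr_nth (shape (Ptab v)) j.
Proof.
move=> hv; have hv' : all (in1n n) v by case/andP: hv.
exists (ins (n.+1 - y) (Ptab (star n v))).2.
by rewrite -(shape_star hv) star_cons shape_Ptab_rcons shape_star.
Qed.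

Lemma lattice2_chi a1 b1 a2 b2 u x : 0 < a1 -> 0 < b1 -> 0 < a2 -> 0 < b2 ->
  lattice2 a1 b1 a2 b2 (rcons u x) -> exists y v,
  [/\ chi [:: (a1, b1); (a2, b2)] (rcons u x) = y :: v, lattice2 a1 b1 a2 b2 (y :: v),
      cells v = cells u & corner_letters a1 a2 x y].
Proof.
move=> ha1 hb1 ha2 hb2 /lattice2E hw.
set R := [:: _; _] in hw *.
have hpos : positive R.
  by move=> i hi; have [->|->] : i = 1 \/ i = 2 by move: hi => /=; lia.
have hx : 0 < x <= ntot R by case: hw; rewrite all_rcons => /andP[].
have [i hi hix] := ex_inA hx.
have [hchi hlat] := chi_lattice hpos hi hix hw.
have ex := lattice_last hi hw hix.
do 2 eexists; split; [exact: hchi|exact/lattice2E|exact: cells_raises|].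
have [ei|ei] : i = 1 \/ i = 2 by move: hi => /=; lia.
  by left; rewrite ex ei /off /eta /rect /=.
by right; rewrite ex ei /off /eta /rect /= addn0.
Qed.

Lemma chi_tau1 a1 b1 a2 b2 w : 0 < a1 -> 0 < b1 -> 0 < a2 -> 0 < b2 ->
  lattice2 a1 b1 a2 b2 w ->
  chi [:: (a2, b2); (a1, b1)] (tau1_word (a1, b1) (a2, b2) w) =
  tau1_word (a1, b1) (a2, b2) (chi [:: (a1, b1); (a2, b2)] w).
Proof.
move=> ha1 hb1 ha2 hb2 hw.
have [] := tau1_wordP hb1 hb2 hw; move: (tau1_word _ _ w) => w'.
case/lastP: w hw => [|u x] hw.
  by case: hw => _ /(_ 1) /=; lia.
case/lastP: w' => [|u' x'] hw' hc.
  by move/(congr1 size): hc; rewrite !size_cells size_rcons.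
have [hcu hci] : cells u' = cells u /\ (ins x' (Ptab u')).2 = (ins x (Ptab u)).2.
  by move/eqP: hc; rewrite !cells_rcons eqseq_rcons => /andP[/eqP -> /eqP ->].
have [y [v [-> hv hcv hxy]]] := lattice2_chi ha1 hb1 ha2 hb2 hw.
have [y' [v' [-> hv' hcv' hxy']]] := lattice2_chi ha2 hb2 ha1 hb1 hw'.
apply: tau1_word_unique => //.
have [vin _ _ _ _] := hv; have [vin' _ _ _ _] := hv'.
apply: cells_cons; [exact: in1n_gt0 vin'|exact: in1n_gt0 vin|by rewrite hcv hcv'|].
have [j sj] := shape_cons vin; have [j' sj'] := shape_cons vin'.
have eu : shape (Ptab u') = shape (Ptab u) by rewrite !shape_cells hcu.
have ev : shape (Ptab v) = shape (Ptab u) by rewrite !shape_cells hcv.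
have ev' : shape (Ptab v') = shape (Ptab u) by rewrite !shape_cells hcv' hcu.
rewrite ev in sj; rewrite ev' in sj'.
set i := (ins x (Ptab u)).2 in hci.
have si : shape (Ptab (rcons u x)) = incr_nth (shape (Ptab u)) i by rewrite shape_Ptab_rcons.
have si' : shape (Ptab (rcons u' x')) = incr_nth (shape (Ptab u')) i.
  by rewrite shape_Ptab_rcons hci.
have [F1 _] := LR2_of_word hb1 hb2 hw; rewrite si in F1.
have [F2 G2] := LR2_of_word hb1 hb2 hv; rewrite sj in F2 G2.
have [G3 F3] := LR2_of_word hb2 hb1 hv'; rewrite sj' in F3 G3.
rewrite sj sj'; case: (j' =P j) => [->//|njj]; exfalso.
have hjj := LR2_shape_two F3 F2 njj.
(* The shape with the added cell in row k contains both rectangles, so a cell in another row l,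
   absent from that shape, lies in neither. *)
have big k l : LR2_shape a1 b1 a2 b2 (incr_nth (shape (Ptab u)) k) ->
    LR2_shape a2 b2 a1 b1 (incr_nth (shape (Ptab u)) k) -> k <> l ->
    (l < a1 /\ nth 0 (shape (Ptab u)) l < b1) \/
    (l < a2 /\ nth 0 (shape (Ptab u)) l < b2) -> False.
  move=> [h1 _ _ _] [h2 _ _ _] nkl [[hl hn]|[hl hn]].
    by have := h1 l hl; rewrite nth_incr_nth; case: eqP => //; lia.
  by have := h2 l hl; rewrite nth_incr_nth; case: eqP => //; lia.
(* If one of the cyclages keeps the row i, its cell lies in a rectangle, against the shape of the
   other; if neither does, j and j' are both complementary to i. *)
case: (i =P j) => [ij|nij].
  apply: (big j' i) => //; first by rewrite ij.
  by apply: (same_cell_in_rectangles ha1 hw hv hcv hxy si); rewrite ij.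
case: (i =P j') => [ij|nij'].
  apply: (big j i) => //; first by move/esym.
  have := same_cell_in_rectangles (i := i) ha2 hw' hv' hcv' hxy' si'.
  by rewrite eu sj' ij => /(_ erefl); case; auto.
by have := LR2_shape_two F1 F2 nij; have := LR2_shape_two F1 F3 nij'; lia.
Qed.

(** * Reduction to two rectangles *)

Lemma eq_from_filters (B : pred nat) u v : map B u = map B v ->
  filter B u = filter B v -> filter (predC B) u = filter (predC B) v -> u = v.
Proof.
elim: u v => [|x u IH] [|y v] //= [exy em].
rewrite -exy; case: ifP => /= _.
  by case=> -> h1 h2; rewrite (IH v).
by move=> h1 [-> h2]; rewrite (IH v).
Qed.

Lemma replace_subP (B : pred nat) w z : all B z -> size z = count B w ->
  [/\ map B (replace_sub B w z) = map B w, filter B (replace_sub B w z) = z &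
      filter (predC B) (replace_sub B w z) = filter (predC B) w].
Proof.
elim: w z => [|x w IH] z /=; first by move=> _ /size0nil ->.
case hx: (B x) => /= hz; last first.
  by rewrite add0n => /(IH _ hz) [h1 h2 h3]; rewrite hx /= h1 h2 h3.
case: z hz => // y z /= /andP[hy hz]; rewrite add1n => -[/(IH _ hz) [h1 h2 h3]].
by rewrite hy /= h1 h2 h3.
Qed.

Lemma map_raise (B : pred nat) r u : B r = B r.+1 -> map B (raise r u) = map B u.
Proof.
move=> hB; elim: u => //= x u IH; case: (eqVneq x r.+1) => [->|_] /=; last by rewrite IH.
by case: ifP => _ /=; rewrite ?hB ?IH.
Qed.

Lemma map_raises (B : pred nat) gs u : (forall r, r \in gs -> B r = B r.+1) ->
  map B (raises gs u) = map B u.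
Proof.
elim: gs u => //= r gs IH u h; rewrite /raises /= -/(raises _ _) IH.
  by apply: map_raise; apply: h; apply: mem_head.
by move=> c hc; apply: h; rewrite inE hc orbT.
Qed.

Lemma raises_filter (B : pred nat) gs u : (forall r, r \in gs -> B r /\ B r.+1) ->
  filter B (raises gs u) = raises gs (filter B u).
Proof.
elim: gs u => //= r gs IH u h; rewrite /raises /= -!/(raises _ _) IH.
  by have [h1 h2] := h r (mem_head _ _); rewrite raise_filter.
by move=> c hc; apply: h; rewrite inE hc orbT.
Qed.

Lemma crystal_shift a r u :
  [/\ eps (a + r) (map (addn^~ a) u) = eps r u,
      phi (a + r) (map (addn^~ a) u) = phi r u &
      raise (a + r) (map (addn^~ a) u) = map (addn^~ a) (raise r u)].
Proof.
elim: u => // x u [he hp hr] /=; rewrite he hp hr.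
have -> : (x + a == (a + r).+1) = (x == r.+1) by lia.
have -> : (x + a == a + r) = (x == r) by lia.
by split=> //; case: ifP => _ //=; rewrite addnC.
Qed.

Lemma raises_shift a b h u : raises (block_gens (a + b) h) (map (addn^~ a) u) =
  map (addn^~ a) (raises (block_gens b h) u).
Proof.
rewrite /block_gens; elim: (iota 1 h.-1) u => //= k s IH u.
rewrite /raises /= -!/(raises _ _) -IH -addnA.
by have [_ _ ->] := crystal_shift a (b + k) u.
Qed.

(** In this form [tauR] is an exchange of r1 and r2 that leaves the offsets of all other blocks
    unchanged. *)
Definition swapped (L D : seq (nat * nat)) (r1 r2 : nat * nat) := L ++ r1 :: r2 :: D.

Section Swap.

Variables (L D : seq (nat * nat)).

Let a := sumn (map fst L).
Let p := (size L).+1.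

Lemma off_swapped r1 r2 : off (swapped L D r1 r2) p = a.
Proof. by rewrite /off /swapped map_cat /= take_size_cat ?size_map. Qed.

Lemma rect_swapped r1 r2 :
  rect (swapped L D r1 r2) p = r1 /\ rect (swapped L D r1 r2) p.+1 = r2.
Proof. by rewrite /rect /swapped /= !nth_cat ltnn subnn ltnNge leqnSn subSnn. Qed.

Lemma off_swappedS r1 r2 : off (swapped L D r1 r2) p.+1 = a + r1.1.
Proof. by rewrite off_succ // off_swapped /eta (rect_swapped r1 r2).1. Qed.

Lemma swapped_other r1 r2 i : 0 < i -> i != p -> i != p.+1 ->
  off (swapped L D r1 r2) i = off (swapped L D r2 r1) i /\
  rect (swapped L D r1 r2) i = rect (swapped L D r2 r1) i.
Proof.
rewrite /p /off /rect /swapped !map_cat /=; case: i => // i _ /= h1 h2.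
case: (leqP i (size L)) => hi.
  have hlt : i < size L by lia.
  by rewrite !take_cat !nth_cat !size_map hlt.
have [k ek] : exists k, i = size L + k.+2 by exists (i - (size L).+2); lia.
rewrite !take_cat !nth_cat !size_map ek !ltnNge leq_addr /= addKn /= !sumn_cat /=.
by split=> //; lia.
Qed.

Lemma inA_swapped r1 r2 i x : 0 < i -> i != p -> i != p.+1 ->
  inA (swapped L D r1 r2) i x = inA (swapped L D r2 r1) i x.
Proof. by move=> h1 h2 h3; rewrite /inA /eta; have [-> ->] := swapped_other r1 r2 h1 h2 h3. Qed.

Lemma ntot_swapped r1 r2 : ntot (swapped L D r1 r2) = ntot (swapped L D r2 r1).
Proof. by rewrite /ntot /swapped !map_cat !sumn_cat /=; lia. Qed.

Lemma positive_swapped r1 r2 : positive (swapped L D r1 r2) ->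
  positive (swapped L D r2 r1).
Proof.
move=> h i hi; have hs : size (swapped L D r1 r2) = size (swapped L D r2 r1).
  by rewrite /swapped !size_cat.
rewrite /eta /mu; case: (eqVneq i p) => [->|n1].
  have := h p.+1; rewrite /eta /mu (rect_swapped r1 r2).2 (rect_swapped r2 r1).1; apply.
  by rewrite /p /swapped size_cat /=; lia.
case: (eqVneq i p.+1) => [->|n2].
  have := h p; rewrite /eta /mu (rect_swapped r1 r2).1 (rect_swapped r2 r1).2; apply.
  by rewrite /p /swapped size_cat /=; lia.
have hi0 : 0 < i by lia.
by have [_ <-] := swapped_other r1 r2 hi0 n1 n2; apply: h; rewrite hs.
Qed.

Lemma positive_pair r1 r2 : positive (swapped L D r1 r2) ->
  [/\ 0 < r1.1, 0 < r1.2, 0 < r2.1 & 0 < r2.2].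
Proof.
move=> h; have hs : p.+1 <= size (swapped L D r1 r2) by rewrite size_cat /= /p; lia.
have [] := h p (ltnW hs); have [] := h p.+1 hs.
by rewrite /eta /mu; have [-> ->] := rect_swapped r1 r2.
Qed.

Definition inB (n : nat) : pred nat := fun x => a < x <= a + n.

Lemma inB_inA r1 r2 x : inB (r1.1 + r2.1) x =
  inA (swapped L D r1 r2) p x || inA (swapped L D r1 r2) p.+1 x.
Proof.
rewrite /inB /inA off_swapped off_swappedS /eta.
have [-> ->] := rect_swapped r1 r2; lia.
Qed.

Lemma inB_other r1 r2 i x : 0 < i -> i != p -> i != p.+1 ->
  inA (swapped L D r1 r2) i x -> ~~ inB (r1.1 + r2.1) x.
Proof.
move=> h1 h2 h3 hx; rewrite (inB_inA r1 r2); apply/negP => /orP[] h.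
  by case/eqP: h2; apply: (inA_inj h1 _ hx h).
by case/eqP: h3; apply: (inA_inj h1 _ hx h).
Qed.

Definition Bpart (n : nat) (w : word) : word := [seq x - a | x <- w & inB n x].

Lemma BpartK n w : [seq x + a | x <- Bpart n w] = filter (inB n) w.
Proof.
rewrite -map_comp -[RHS]map_id; apply/eq_in_map => x; rewrite mem_filter /inB /= => /andP[]; lia.
Qed.

Lemma count_shift x u : count_mem (a + x) (map (addn^~ a) u) = count_mem x u.
Proof. by rewrite count_map; apply: eq_count => y /=; lia. Qed.

Lemma size_swapped r1 r2 : size (swapped L D r1 r2) = size L + (size D).+2.
Proof. by rewrite size_cat. Qed.

Lemma lattice_Bpart r1 r2 w : lattice (swapped L D r1 r2) w ->
  lattice2 r1.1 r1.2 r2.1 r2.2 (Bpart (r1.1 + r2.1) w).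
Proof.
move=> [_ hl]; set n := r1.1 + r2.1; set R := swapped L D r1 r2 in hl.
have hszR := size_swapped r1 r2; rewrite -/R in hszR.
have [c1 e1] := hl p ltac:(rewrite hszR /p; lia).
have [c2 e2] := hl p.+1 ltac:(rewrite hszR /p; lia).
move: c1 e1 c2 e2; rewrite /inA off_swapped off_swappedS /eta /mu.
have [-> ->] := rect_swapped r1 r2 => c1 e1 c2 e2.
have hc x : 0 < x <= n -> count_mem x (Bpart n w) = count_mem (a + x) w.
  move=> hx; rewrite -(count_shift x) BpartK count_filter_in // /inB; lia.
have he r : 0 < r < n -> eps r (Bpart n w) = eps (a + r) w.
  move=> hr; have [<- _ _] := crystal_shift a r (Bpart n w).
  by rewrite BpartK eps_filter // /inB; lia.
split.
- apply/allP => x /mapP [y]; rewrite mem_filter /inB /in1n => /andP[hy _] ->; lia.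
- by move=> x hx; rewrite hc ?c1 //; lia.
- by move=> x hx; rewrite hc ?c2 //; lia.
- by move=> r hr; rewrite he ?e1 //; lia.
- by move=> r hr; rewrite he ?e2 //; lia.
Qed.

(** The conditions for the two exchanged blocks are inherited from t; those of the other blocks only
    see letters that the replacement keeps. *)
Lemma lattice_replace r1 r2 w t : lattice (swapped L D r1 r2) w ->
  lattice2 r2.1 r2.2 r1.1 r1.2 t -> size t = size (Bpart (r1.1 + r2.1) w) ->
  lattice (swapped L D r2 r1) (replace_sub (inB (r1.1 + r2.1)) w [seq x + a | x <- t]).
Proof.
move=> [hall hl] [t0 t1 t2 t3 t4] hsz; set n := r1.1 + r2.1.
have hBt : all (inB n) [seq x + a | x <- t].
  by rewrite all_map; apply: sub_all t0 => x; rewrite /in1n /inB /n /=; lia.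
have [||_ hB hC] := @replace_subP (inB n) w [seq x + a | x <- t]; first exact: hBt.
  by rewrite size_map hsz size_map size_filter.
set w' := replace_sub _ _ _ in hB hC *.
have hp : perm_eq (filter (inB n) w' ++ filter (predC (inB n)) w') w' by rewrite perm_filterC.
split.
  rewrite -(perm_all _ hp) all_cat hB hC -(ntot_swapped r1 r2); apply/andP; split.
    apply/allP => x /(allP hBt); have := off_ntot (R := swapped L D r1 r2) (i := p.+1).
    rewrite off_succ // off_swappedS /eta (rect_swapped r1 r2).2 size_swapped /inB /in1n /n; lia.
  by apply/allP => x; rewrite mem_filter => /andP[_ /(allP hall)].
move=> i; rewrite size_swapped => hi.
have hcB x : inB n x -> count_mem x w' = count_mem (x - a) t.
  move=> hx; rewrite -(count_filter_in (B := inB n)) // hB -(count_shift (x - a) t) subnKC //.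
  by move: hx; rewrite /inB; lia.
have heB r : inB n r -> inB n r.+1 -> eps r w' = eps (r - a) t.
  move=> h1 h2; rewrite -(eps_filter w' h1 h2).1 hB.
  have [<- _ _] := crystal_shift a (r - a) t.
  by rewrite subnKC //; move: h1; rewrite /inB; lia.
case: (eqVneq i p) => [->|n1].
  rewrite /inA off_swapped /eta /mu (rect_swapped r2 r1).1.
  split=> [x hx|r h1 h2]; first by rewrite hcB ?t1 // /inB /n; lia.
  by rewrite heB ?t3 // /inB /n; lia.
case: (eqVneq i p.+1) => [->|n2].
  rewrite /inA off_swappedS /eta /mu (rect_swapped r2 r1).2.
  split=> [x hx|r h1 h2]; first by rewrite hcB ?t2 // /inB /n; lia.
  by rewrite heB ?t4 // /inB /n; lia.
have hi0 : 0 < i by lia.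
have [hc he] := hl i ltac:(by rewrite size_swapped).
have [ho hr] := swapped_other r1 r2 hi0 n1 n2.
split=> [x|r]; rewrite -!(inA_swapped r1 r2) // => h1.
  have hx := inB_other hi0 n1 n2 h1.
  rewrite -(count_filter_in (B := predC (inB n))) // hC count_filter_in // hc //.
  by rewrite /mu hr.
move=> h2; have hx := inB_other hi0 n1 n2 h1; have hx2 := inB_other hi0 n1 n2 h2.
rewrite -(eps_filter (B := predC (inB n)) w' hx hx2).1 hC.
by rewrite (eps_filter (B := predC (inB n)) w hx hx2).1 he.
Qed.

(* The cyclage map acts on the mask, on the letters inside the two blocks and
   on the letters outside of them separately. *)
Lemma chi_parts r1 r2 u x : positive (swapped L D r1 r2) ->
  lattice (swapped L D r1 r2) (rcons u x) ->
  let n := r1.1 + r2.1 in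
  let R := swapped L D r1 r2 in
  [/\ map (inB n) (chi R (rcons u x)) = inB n x :: map (inB n) u,
      Bpart n (chi R (rcons u x)) =
        if inB n x then chi [:: r1; r2] (Bpart n (rcons u x)) else Bpart n (rcons u x) &
      if inB n x then filter (predC (inB n)) (chi R (rcons u x)) = filter (predC (inB n)) u
      else exists i, [/\ 0 < i, i != p, i != p.+1, inA R i x &
        filter (predC (inB n)) (chi R (rcons u x)) =
          (off R i + eta R i) ::
            raises (block_gens (off R i) (eta R i)) (filter (predC (inB n)) u)]].
Proof.
move=> hpos hlat n R; have [hall _] := hlat.
have hx : 0 < x <= ntot R by move: hall; rewrite all_rcons => /andP[].
have [i hi hix] := ex_inA hx; have [-> _] := chi_lattice hpos hi hix hlat.
have hi0 : 0 < i by lia.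
have [heta _] := hpos i hi; rewrite -/R in heta.
have ex := lattice_last hi hlat hix; rewrite -/R in ex.
have htop : inA R i (off R i + eta R i) by rewrite /inA; lia.
have hgs r : r \in block_gens (off R i) (eta R i) -> inA R i r /\ inA R i r.+1.
  by move=> /block_gensP hr; rewrite /inA; lia.
case: (boolP (inB n x)) => hB; last first.
  have n1 : i != p by apply: contraNneq hB => ei; rewrite (inB_inA r1 r2) -ei hix.
  have n2 : i != p.+1 by apply: contraNneq hB => ei; rewrite (inB_inA r1 r2) -ei hix orbT.
  have ho c : inA R i c -> ~~ inB n c by exact: inB_other.
  have hgo r : r \in block_gens (off R i) (eta R i) -> ~~ inB n r /\ ~~ inB n r.+1.
    by move=> /hgs [/ho h1 /ho h2].
  split.
  - rewrite /= (negbTE (ho _ htop)) map_raises // => r /hgo [h1 h2].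
    by rewrite (negbTE h1) (negbTE h2).
  - rewrite /Bpart /= (negbTE (ho _ htop)) filter_raises // filter_rcons (negbTE hB).
    by [].
  exists i; split=> //=; rewrite (ho _ htop) raises_filter // => r /hgo [h1 h2].
have hio : i = p \/ i = p.+1.
  move: hB; rewrite (inB_inA r1 r2) => /orP[] h; [left|right]; exact: (inA_inj hi0 _ hix h).
have ho c : inA R i c -> inB n c.
  by rewrite (inB_inA r1 r2); case: hio => -> ->; rewrite ?orbT.
have hgo r : r \in block_gens (off R i) (eta R i) -> inB n r /\ inB n r.+1.
  by move=> /hgs [/ho h1 /ho h2].
have hlB := lattice_Bpart hlat; rewrite -/n in hlB.
have hBr : Bpart n (rcons u x) = rcons (Bpart n u) (x - a).
  by rewrite /Bpart filter_rcons hB map_rcons.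
(* One computation serves both blocks, q being the index of the block within the pair. *)
have hshift q : off R i = a + off [:: r1; r2] q -> eta R i = eta [:: r1; r2] q ->
    1 <= q <= 2 -> positive [:: r1; r2] ->
    Bpart n (off R i + eta R i :: raises (block_gens (off R i) (eta R i)) u) =
    chi [:: r1; r2] (Bpart n (rcons u x)).
  move=> hof het hq hp2.
  have hlB' : lattice [:: r1; r2] (Bpart n (rcons u x)).
    by move: hlB; case: (r1) (r2) => ? ? [? ?] /lattice2E.
  rewrite hBr in hlB' *.
  have hxq : inA [:: r1; r2] q (x - a) by move: hix; rewrite /inA hof het; lia.
  have [-> _] := chi_lattice hp2 hq hxq hlB'.
  rewrite /Bpart /= (ho _ htop) /= raises_filter //; congr (_ :: _).
    by rewrite hof het; lia.
  rewrite -[in LHS]BpartK hof het raises_shift -map_comp -[RHS]map_id.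
  by apply: eq_map => c /=; rewrite addnK.
split.
- rewrite /= (ho _ htop) map_raises // => r /hgo [h1 h2].
  by rewrite h1 h2.
- have hp2 : positive [:: r1; r2].
    move=> j hj; have [? ? ? ?] := positive_pair hpos.
    by have [->|->] : j = 1 \/ j = 2 by move: hj => /=; lia.
  case: hio => ei.
    by apply: (hshift 1) => //; rewrite ei /R ?off_swapped ?/eta ?(rect_swapped r1 r2).1 //= ?/off ?addn0.
  apply: (hshift 2) => //; rewrite ei /R ?off_swappedS ?/eta ?(rect_swapped r1 r2).2 //=.
  by rewrite /off /= addn0.
rewrite /= (ho _ htop) /= filter_raises // => r /hgo [h1 h2].
by rewrite /= h1 h2.
Qed.

Lemma lattice_chi R w : positive R -> 0 < size w -> lattice R w -> lattice R (chi R w).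
Proof.
move=> hpos; case/lastP: w => // u x _ hw.
have hx : 0 < x <= ntot R by case: hw; rewrite all_rcons => /andP[].
have [i hi hix] := ex_inA hx.
by have [-> ] := chi_lattice hpos hi hix hw.
Qed.

Lemma tau_word_swapped r1 r2 w : tau_word (swapped L D r1 r2) p w =
  replace_sub (inB (r1.1 + r2.1)) w
    [seq x + a | x <- tau1_word r1 r2 (Bpart (r1.1 + r2.1) w)].
Proof.
rewrite /tau_word /eta off_swapped; have [-> ->] := rect_swapped r1 r2.
by rewrite -addnA.
Qed.

Lemma tau1_word_inB r1 r2 w : positive (swapped L D r1 r2) ->
  lattice (swapped L D r1 r2) w ->
  let n := r1.1 + r2.1 in
  let t := tau1_word r1 r2 (Bpart n w) in
  [/\ lattice2 r2.1 r2.2 r1.1 r1.2 t, size t = size (Bpart n w),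
      all (inB n) [seq x + a | x <- t] & size [seq x + a | x <- t] = count (inB n) w].
Proof.
move=> /positive_pair [_ h1 _ h2] /lattice_Bpart hw n t.
have [ht hc] : lattice2 r2.1 r2.2 r1.1 r1.2 t /\ cells t = cells (Bpart n w).
  by move: h1 h2 hw; rewrite /t /n; case: (r1) (r2) => ? ? [? ?]; exact: tau1_wordP.
have hs : size t = size (Bpart n w) by rewrite -(size_cells t) hc size_cells.
split=> //; last by rewrite size_map hs size_map size_filter.
rewrite all_map; case: ht => h _ _ _ _; apply: sub_all h => x.
by rewrite /in1n /inB /n /=; lia.
Qed.

(** A word is determined by its mask and by its letters inside and outside the two blocks. Inside,
    [chi_parts] reduces the claim to [chi_tau1]; the mask and the outer letters are untouched by
    [tau_word]. *)
Lemma chi_tau_swapped r1 r2 w : positive (swapped L D r1 r2) ->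
  lattice (swapped L D r1 r2) w ->
  chi (swapped L D r2 r1) (tau_word (swapped L D r1 r2) p w) =
  tau_word (swapped L D r1 r2) p (chi (swapped L D r1 r2) w).
Proof.
move=> hpos; case/lastP: w => [//|u x] hw.
set n := r1.1 + r2.1; set R := swapped L D r1 r2; set R' := swapped L D r2 r1.
have [t0 ts tB tc] := tau1_word_inB hpos hw.
have hz := lattice_chi hpos (_ : 0 < size (rcons u x)) hw.
have {hz} hz : lattice R (chi R (rcons u x)) by apply: hz; rewrite size_rcons.
have [_ _ zB zc] := tau1_word_inB hpos hz.
have hw' := lattice_replace hw t0 ts.
rewrite !tau_word_swapped -/n in tB tc zB zc hw' *.
have [hm hB hC] := replace_subP tB tc; have [gm gB gC] := replace_subP zB zc.
set t := tau1_word r1 r2 (Bpart n (rcons u x)) in t0 ts tB tc hw' hm hB hC *.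
set w' := replace_sub _ _ [seq _ | _ <- t] in hw' hm hB hC *.
have hBt : Bpart n w' = t.
  by rewrite /Bpart hB -map_comp -[RHS]map_id; apply: eq_map => c /=; rewrite addnK.
clearbody w'; case/lastP: w' hw' hm hB hC hBt => [|u' x'] hw' hm hB hC hBt.
  by move/(congr1 size): hm; rewrite !size_map size_rcons.
have [m1 b1 c1] := chi_parts hpos hw.
have [m2 b2 c2] := chi_parts (positive_swapped hpos) hw'.
rewrite -/R -/R' -/n [r2.1 + r1.1]addnC -/n in m1 b1 c1 m2 b2 c2.
have [emu ex] : map (inB n) u' = map (inB n) u /\ inB n x' = inB n x.
  by move/eqP: hm; rewrite !map_rcons eqseq_rcons => /andP[/eqP -> /eqP ->].
apply: (@eq_from_filters (inB n)).
- by rewrite gm m1 m2 emu ex.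
(* If the last letter is outside the two blocks, neither cyclage changes the inner part. *)
- rewrite gB -BpartK b2 b1 hBt ex; congr map; case: ifP => // _.
  have [h1 h2 h3 h4] := positive_pair hpos; have hwB := lattice_Bpart hw.
  move: h1 h2 h3 h4 hwB; rewrite /t /n; case: (r1) (r2) => ? ? [? ?] h1 h2 h3 h4 hwB.
  exact: chi_tau1.
rewrite gC; move: c1 c2 hC; rewrite ex !filter_rcons /= ex; case: ifP => /= _.
  by move=> -> -> ->.
(* Both words end in the same letter, whose block has the same index, offset and height in R and in
   R'. *)
move=> [i [i0 i1 i2 ix ->]] [j [j0 j1 j2 jx ->]] /eqP.
rewrite eqseq_rcons => /andP[/eqP -> /eqP exx]; rewrite exx -inA_swapped // in jx.
have -> := inA_inj j0 i0 jx ix.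
by rewrite /eta; have [-> ->] := swapped_other r1 r2 i0 i1 i2.
Qed.

End Swap.

Theorem theorem3p5 (R : seq (nat * nat)) :
  (forall i, 1 <= i <= size R -> 0 < eta R i /\ 0 < mu R i) ->
  forall p, 1 <= p <= (size R).-1 ->
  forall w, inW R w ->
    chi (tauR R p) (tau_word R p w) = tau_word R p (chi R w).
Proof.
move=> hpos p hp w /inW_lattice hw.
have {}hw := hw (fun i hi => (hpos i hi).2).
have sL : (size (take p.-1 R)).+1 = p by rewrite size_takel; lia.
have eR : R = swapped (take p.-1 R) (drop p.+1 R) (rect R p) (rect R p.+1).
  rewrite /swapped -[LHS](cat_take_drop p.-1) (drop_nth (0, 0)); last lia.
  by rewrite prednK ?(drop_nth (0, 0) (n := p)) //; lia.
rewrite /tauR -[[:: rect R p.+1; rect R p] ++ _]/(rect R p.+1 :: rect R p :: drop p.+1 R).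
rewrite -/(swapped (take p.-1 R) (drop p.+1 R) (rect R p.+1) (rect R p)).
move: hpos hw; move: (take p.-1 R) (drop p.+1 R) (rect R p) (rect R p.+1) eR sL.
by move=> L D r1 r2 -> <- hpos hw; apply: chi_tau_swapped.
Qed.
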